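(* Let $I\subseteq\mathbb{R}$ be a nonempty interval and let $f:I\to\mathbb{R}$ be operator convex. For every $\lambda\in(0,1)$, $\alpha\in[0,1]$ and all $A,B\in\mathcal{S}_I(H)$, $$f\big(A\nabla_{r(\lambda,\alpha)}B\big)\le\int_0^1 f\big(A\nabla_{r(\lambda,t)}B\big)\,d\eta_\alpha(t)\le f\big(A\nabla_\lambda B\big)\nabla_\alpha f\big(A\nabla_{1-\lambda}B\big)\le\mathcal{M}_{\lambda,\alpha}(f;A,B)\le f(A)\nabla_{r(\lambda,\alpha)}f(B).$$ If $f$ is operator concave, all the inequalities are reversed.
   Context: $H$ is a complex Hilbert space, $\mathcal{B}(H)$ the bounded linear operators on $H$. For self-adjoint operators, $A\le B$ means that $B-A$ is positive. $\mathcal{S}_I(H)$ is the set of self-adjoint operators in $\mathcal{B}(H)$ with spectrum contained in $I$; for $f:I\to\mathbb{R}$ (continuous) and $A\in\mathcal{S}_I(H)$, $f(A)$ is defined by the continuous functional calculus. $f$ is operator convex (resp. concave) on $I$ if $f((1-\lambda)A+\lambda B)\le$ (resp. $\ge$) $(1-\lambda)f(A)+\lambda f(B)$ for all $A,B\in\mathcal{S}_I(H)$, $\lambda\in[0,1]$. For $X,Y\in\mathcal{B}(H)$ and $\lambda\in[0,1]$, $X\nabla_\lambda Y:=(1-\lambda)X+\lambda Y$. For $\lambda\in(0,1)$, $\eta_\lambda$ is the probability measure on $[0,1]$ given by $d\eta_\lambda(t)=\frac{\lambda}{1-\lambda}\,t^{\frac{2\lambda-1}{1-\lambda}}\,dt$;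 at the endpoints $\eta_0$ and $\eta_1$ are understood as the weak limits of $\eta_\lambda$ as $\lambda\to0$ and $\lambda\to1$, i.e. the Dirac measures at $0$ and at $1$. For $\nu,\alpha\in[0,1]$, $r(\nu,\alpha):=\nu+\alpha-2\nu\alpha$. For $\lambda\in(0,1)$, $\alpha\in[0,1]$, $\sigma_{\lambda,\alpha}:=(1-\alpha)\eta_\lambda+\alpha\,\eta_{1-\lambda}$ and $\mathcal{M}_{\lambda,\alpha}(f;A,B):=\int_0^1 f(A\nabla_t B)\,d\sigma_{\lambda,\alpha}(t)$. Integrals of operator-valued functions are norm integrals. *)

(* Defs.v *)
From HB Require Import structures.
From mathcomp Require Import all_boot all_order all_algebra.
From mathcomp Require Import sesquilinear complex.
From mathcomp Require Import all_classical all_reals all_analysis.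
From mathcomp Require Import measurable_realfun.

Set Implicit Arguments.
Unset Strict Implicit.
Unset Printing Implicit Defensive.

Import Order.TTheory GRing.Theory Num.Theory.
Import numFieldNormedType.Exports.

Local Open Scope classical_set_scope.
Local Open Scope complex_scope.
Local Open Scope ring_scope.

HB.mixin Record isHilbert (R : realType) H & CompleteNormedModule R[i] H := {
  inner : {dot H for (@Num.conj R[i])} ;
  inner_norm : forall x : H, inner x x = `|x| ^+ 2
}.

#[short(type="hilbertType")]
HB.structure Definition Hilbert (R : realType) :=
  {H of CompleteNormedModule R[i] H & isHilbert R H}.

Section bounded_operators.
Context {R : realType} {H : hilbertType R}.
Implicit Types (T : H -> H).

Definition bounded_linear_pred : {pred H -> H} := fun T =>
  `[< linear T /\ exists M : R[i], forall x, `|T x| <= M * `|x| >].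

Structure bop := Bop {
  bop_fun :> H -> H ;
  _ : bop_fun \in bounded_linear_pred }.

HB.instance Definition _ := [isSub for bop_fun].
HB.instance Definition _ := [Choice of bop by <:].

Lemma bounded_linearP T : reflect
  (linear T /\ exists M : R[i], forall x, `|T x| <= M * `|x|)
  (T \in bounded_linear_pred).
Proof. exact: asboolP. Qed.

Lemma bop_submod : submod_closed bounded_linear_pred.
Proof.
split.
  apply/bounded_linearP; split=> [a x y /=|].
    by change (0 = a *: 0 + 0 :> H); rewrite scaler0 addr0.
  by exists 0 => x; rewrite mul0r [_ x]/(0 : H) normr0.
move=> a S T /bounded_linearP[lS [M hM]] /bounded_linearP[lT [N hN]].
apply/bounded_linearP; split=> [b x y|].
  rewrite !fctE lS lT !scalerDr !scalerA addrACA; congr (_ + _ + _).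
  by rewrite mulrC.
exists (`|a| * M + N) => x; rewrite !fctE.
rewrite (le_trans (ler_normD _ _))// mulrDl lerD//.
by rewrite normrZ -mulrA ler_wpM2l.
Qed.

HB.instance Definition _ :=
  GRing.isSubmodClosed.Build R[i] (H -> H) bounded_linear_pred bop_submod.
HB.instance Definition _ := [SubChoice_isSubLmodule of bop by <:].

Implicit Types A B C : bop.

Lemma bop_linear A : linear A.
Proof. by have /bounded_linearP[] := valP A. Qed.

HB.instance Definition _ A :=
  GRing.isLinear.Build R[i] H H *:%R (bop_fun A) (@bop_linear A).

Lemma bop_bounded A : exists M : R[i], forall x, `|A x| <= M * `|x|.
Proof. by have /bounded_linearP[] := valP A. Qed.

Lemma bopP A B : A =1 B -> A = B.
Proof. by move=> AB; apply: val_inj; apply/funext. Qed.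

Lemma bopDE A B x : (A + B) x = A x + B x. Proof. by []. Qed.
Lemma bopNE A x : (- A) x = - A x. Proof. by []. Qed.
Lemma bopZE a A x : (a *: A) x = a *: A x. Proof. by []. Qed.
Lemma bop0E x : (0 : bop) x = 0. Proof. by []. Qed.

Lemma bop_id_subproof : (idfun : H -> H) \in bounded_linear_pred.
Proof.
by apply/bounded_linearP; split=> //; exists 1 => x; rewrite mul1r.
Qed.
Definition bop_id : bop := Bop bop_id_subproof.

Lemma bop_comp_subproof A B : A \o B \in bounded_linear_pred.
Proof.
apply/bounded_linearP; split=> [a x y /=|]; first by rewrite !linearP.
have [M hM] := bop_bounded A; have [N hN] := bop_bounded B.
exists (`|M| * N) => x /=; rewrite (le_trans (hM _))//.
have [->|Bx0] := eqVneq (B x) 0.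
  rewrite normr0 mulr0 -mulrA mulr_ge0//.
  by rewrite (le_trans _ (hN x)).
have M0 : 0 <= M.
  by rewrite -(pmulr_lge0 M (_ : 0 < `|B x|)) ?normr_gt0// (le_trans _ (hM _)).
by rewrite ger0_norm// -mulrA ler_wpM2l.
Qed.
Definition bop_comp A B : bop := Bop (bop_comp_subproof A B).

Lemma bop_compA : associative bop_comp. Proof. by move=> A B C; exact: bopP. Qed.
Lemma bop_comp1l : left_id bop_id bop_comp. Proof. by move=> A; exact: bopP. Qed.
Lemma bop_comp1r : right_id bop_id bop_comp. Proof. by move=> A; exact: bopP. Qed.
Lemma bop_compDl : left_distributive bop_comp +%R.
Proof. by move=> A B C; exact: bopP. Qed.
Lemma bop_compDr : right_distributive bop_comp +%R.
Proof. by move=> A B C; apply: bopP => x /=; rewrite linearD. Qed.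

HB.instance Definition _ := GRing.Zmodule_isPzRing.Build bop
  bop_compA bop_comp1l bop_comp1r bop_compDl bop_compDr.

(* norms over R[i] take real nonnegative values in R[i], hence the real parts *)
Definition opnorm A : R := sup [set complex.Re `|A x| | x in [set x | `|x| <= 1]].

Lemma norm_Re (x : H) : (complex.Re `|x|)%:C = `|x|.
Proof. by rewrite RRe_real// ger0_real. Qed.

Lemma opnorm_has_sup A :
  has_sup [set complex.Re `|A x| | x in [set x | `|x| <= 1]].
Proof.
split; first by exists (complex.Re `|A 0|), 0 => //=; rewrite normr0.
have [M hM] := bop_bounded A.
exists (complex.Re `|M|) => _ [x x1 <-].
rewrite -lecR norm_Re RRe_real ?ger0_real//.
have [->|x0] := eqVneq x 0; first by rewrite linear0 normr0.
have M0 : 0 <= M.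
  by rewrite -(pmulr_lge0 M (_ : 0 < `|x|)) ?normr_gt0// (le_trans _ (hM _)).
by rewrite ger0_norm// (le_trans (hM x))// ler_piMr.
Qed.

Lemma opnorm_ub A x : `|x| <= 1 -> `|A x| <= (opnorm A)%:C.
Proof.
move=> x1; rewrite -norm_Re lecR.
by apply: ub_le_sup; [have [] := opnorm_has_sup A|exists x].
Qed.

Lemma opnorm_le A (M : R) :
  (forall x, `|x| <= 1 -> `|A x| <= M%:C) -> opnorm A <= M.
Proof.
move=> h; apply: ge_sup; first by have [] := opnorm_has_sup A.
by move=> _ [x /= x1 <-]; rewrite -lecR norm_Re h.
Qed.

Lemma opnorm_ge0 A : 0 <= opnorm A.
Proof.
by rewrite -lecR (le_trans _ (@opnorm_ub A 0 _))// normr0.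
Qed.

Lemma bop_normD A B : (opnorm (A + B))%:C <= (opnorm A)%:C + (opnorm B)%:C.
Proof.
rewrite -rmorphD lecR; apply: opnorm_le => x x1.
by rewrite rmorphD (le_trans (ler_normD _ _))// lerD// opnorm_ub.
Qed.

Lemma bop_normZle a A : (opnorm (a *: A))%:C <= `|a| * (opnorm A)%:C.
Proof.
have -> : `|a| = (complex.Re `|a|)%:C by rewrite RRe_real// ger0_real.
rewrite -rmorphM lecR; apply: opnorm_le => x x1.
rewrite rmorphM bopZE normrZ [X in _ <= X * _]RRe_real ?ger0_real//.
by rewrite ler_wpM2l// opnorm_ub.
Qed.

Lemma bop_normZ a A : (opnorm (a *: A))%:C = `|a| * (opnorm A)%:C.
Proof.
apply/eqP; rewrite eq_le bop_normZle/=.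
have [->|a0] := eqVneq a 0; first by rewrite normr0 mul0r lecR opnorm_ge0.
rewrite -ler_pdivlMl ?normr_gt0// -normfV.
by rewrite (le_trans _ (bop_normZle _ _))// scalerA mulVf// scale1r.
Qed.

Lemma bop_norm0_eq0 A : (opnorm A)%:C = 0 -> A = 0.
Proof.
move=> A0; apply: bopP => x; rewrite bop0E.
have [->|x0] := eqVneq x 0; first by rewrite linear0.
have : `|A (`|x|^-1 *: x)| <= 0.
  rewrite -A0; apply: opnorm_ub.
  by rewrite normrZ normfV normr_id mulVf// normr_eq0.
rewrite linearZ normr_le0 scaler_eq0 invr_eq0 normr_eq0 (negbTE x0)/=.
by move/eqP.
Qed.

HB.instance Definition _ := @Lmodule_isNormed.Build R[i] bop
  (fun A => (opnorm A)%:C) bop_normD bop_normZ bop_norm0_eq0.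

End bounded_operators.
Arguments bop {R} H.
Notation "''B(' H )" := (bop H) (format "''B(' H )") : type_scope.

Section operator_notions.
Context {R : realType} {H : hilbertType R}.
Implicit Types (A B : 'B(H)) (I : set R) (f : R -> R).

Definition self_adjoint A := forall x y : H, inner (A x) y = inner x (A y).

(* the order of R[i] makes [0 <= z] say that z is real and nonnegative *)
Definition positive_op A := forall x : H, 0 <= inner (A x) x.

Definition op_le A B := positive_op (B - A).

Definition spectrum A : set R[i] :=
  [set z | ~ exists B, B * (A - z *: (1 : 'B(H))) = 1 /\
                       (A - z *: (1 : 'B(H))) * B = 1].

Definition self_adjoint_on I : set 'B(H) :=
  [set A | self_adjoint A /\ spectrum A `<=` [set x%:C | x in I]].

Definition op_horner (p : {poly R}) A : 'B(H) :=
  \sum_(i < size p) (p`_i)%:C *: A ^+ i.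

(* f(A) is the norm limit of p_n(A) for any real polynomials p_n that converge
   to f uniformly on the spectrum of A *)
Definition is_cfc f A : set 'B(H) :=
  [set T | exists2 p : nat -> {poly R},
    {uniform [set x : R | spectrum A x%:C],
      (fun n (x : R) => (p n).[x]) @ \oo --> f} &
    op_horner (p n) A @[n --> \oo] --> T].

Definition cfc f A : 'B(H) := xget 0 (is_cfc f A).

Definition nabla (l : R) A B : 'B(H) := (1 - l)%:C *: A + l%:C *: B.

Definition operator_convex I f := forall A B, self_adjoint_on I A ->
  self_adjoint_on I B -> forall l : R, 0 <= l <= 1 ->
  op_le (cfc f (nabla l A B)) (nabla l (cfc f A) (cfc f B)).

Definition operator_concave I f := forall A B, self_adjoint_on I A ->
  self_adjoint_on I B -> forall l : R, 0 <= l <= 1 ->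
  op_le (nabla l (cfc f A) (cfc f B)) (cfc f (nabla l A B)).

End operator_notions.
Arguments operator_convex {R} H I f.
Arguments operator_concave {R} H I f.

Notation "A '<=op' B" := (op_le A B) (at level 70, no associativity).

Section bochner.
Context d (T : measurableType d) (R : realType) (V : normedModType R[i]).
Implicit Types (mu : {measure set T -> \bar R}) (D : set T) (s : seq (set T * V)).

(* s represents the simple function \sum_((E, v) <- s) \1_E *: v on D *)
Definition simple_on mu D s :=
  {in s, forall Ev, [/\ measurable Ev.1, Ev.1 `<=` D & (mu Ev.1 < +oo)%E]}.

Definition simple_val s (t : T) : V := \sum_(Ev <- s) (\1_(Ev.1) t)%:C *: Ev.2.

Definition simple_int mu s : V := \sum_(Ev <- s) (fine (mu Ev.1))%:C *: Ev.2.

Definition is_bochner mu D (F : T -> V) : set V :=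
  [set v | exists s : nat -> seq (set T * V), [/\
    forall n, simple_on mu D (s n),
    {ae mu, forall t, D t -> simple_val (s n) t @[n --> \oo] --> F t},
    (\int[mu]_(t in D) (complex.Re `|F t - simple_val (s n) t|%R)%:E)%E
      @[n --> \oo] --> 0%E &
    simple_int mu (s n) @[n --> \oo] --> v]].

(* 0 if F is not Bochner integrable *)
Definition bochner mu D (F : T -> V) : V := xget 0 (is_bochner mu D F).

End bochner.

Section eta.
Context {R : realType}.

Definition eta_pdf (l t : R) : R :=
  l / (1 - l) * t `^ ((2 * l - 1) / (1 - l)).

(* The weak limits of eta l as l -> 0 and l -> 1 are the Dirac masses at 0 and
   at 1; values of l outside `[0, 1] are irrelevant. *)
Definition eta (l : R) (E : set (measurableTypeR R)) : \bar R :=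
  if l <= 0 then \d_(0 : measurableTypeR R) E
  else if 1 <= l then \d_(1 : measurableTypeR R) E
  else (\int[lebesgue_measure]_(t in E `&` `[0%R, 1%R]) (eta_pdf l t)%:E)%E.

Let eta0 l : eta l set0 = 0%E.
Proof. by rewrite /eta !measure0 set0I integral_set0 !if_same. Qed.

Lemma eta_pdf_ge0 l t : 0 < l -> l < 1 -> 0 <= eta_pdf l t.
Proof.
move=> l0 l1; rewrite /eta_pdf mulr_ge0// ?powR_ge0// divr_ge0// ltW//.
by rewrite subr_gt0.
Qed.

Lemma measurable_eta_pdf l : measurable_fun setT (eta_pdf l).
Proof. by apply: measurable_funM => //; exact: measurable_powR. Qed.

Let eta_ge0 l E : (0 <= eta l E)%E.
Proof.
rewrite /eta; case: (leP l 0) => // l0; case: (leP 1 l) => // l1.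
by apply: integral_ge0 => t _; rewrite lee_fin eta_pdf_ge0.
Qed.

Let eta_sigma_additive l : semi_sigma_additive (eta l).
Proof.
rewrite /eta; case: (leP l 0) => l0; first exact: measure_semi_sigma_additive.
case: (leP 1 l) => l1; first exact: measure_semi_sigma_additive.
move=> F mF tF mUF; apply: cvg_toP.
  apply: ereal_nondecreasing_is_cvgn => m n mn.
  apply: lee_sum_nneg_natr => // k _ _; apply: integral_ge0 => /= x Fkx.
  by rewrite lee_fin eta_pdf_ge0.
rewrite setI_bigcupl ge0_integral_bigcup//=.
- by move=> k; exact: measurableI.
- by apply/measurable_funTS/measurableT_comp => //; exact: measurable_eta_pdf.
- by move=> x _; rewrite lee_fin eta_pdf_ge0.
- exact: trivIset_setIr.
Qed.

HB.instance Definition _ l := isMeasure.Build _ _ _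
  (eta l) (eta0 l) (eta_ge0 l) (@eta_sigma_additive l).

Definition sigma (l : R) (a : {i01 R}) :
    {measure set (measurableTypeR R) -> \bar R} :=
  measure_add (mscale (1 - a%:num)%:nng (eta l))
              (mscale a%:num%:nng (eta (1 - l))).

Definition r_weight (nu a : R) : R := nu + a - 2 * nu * a.

End eta.

Definition Mean {R : realType} {H : hilbertType R} (l : R) (a : {i01 R})
    (f : R -> R) (A B : 'B(H)) : 'B(H) :=
  bochner (sigma l a) `[0, 1] (fun t => cfc f (nabla t A B)).

(* Main.v *)
From HB Require Import structures.
Require Import Defs.
From mathcomp Require Import all_boot all_order all_algebra.
From mathcomp Require Import sesquilinear complex ring lra.
From mathcomp Require Import all_classical all_reals all_analysis.
From mathcomp Require Import measurable_realfun.

(** Restricted to the segment [t |-> A nabla_t B], an operator convex [f] yields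
    a convex map [F] from [0, 1] to self-adjoint operators.  Every inequality is
    tested on the quadratic forms [t |-> <F t x, x>], real convex functions to
    which Jensen's inequality and the chord bound apply, since [eta b] is a
    probability measure of mean [b].

    Convexity alone makes [F] bounded and norm-continuous on ]0, 1[, because the
    norm of a self-adjoint operator is its numerical radius; hence step functions
    approximate [F] and the Bochner integrals exist; the functional calculus
    enters only through the self-adjointness of [F t].  That the segment stays in
    the domain of [f] follows because the infimum and the supremum of the
    quadratic form of a self-adjoint operator belong to its spectrum, while
    conversely bounds on the form bound the spectrum (Lax-Milgram). *)

Set Implicit Arguments.
Unset Strict Implicit.
Unset Printing Implicit Defensive.

Import Order.TTheory GRing.Theory Num.Theory.
Import numFieldNormedType.Exports.

Local Open Scope classical_set_scope.
Local Open Scope complex_scope.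
Local Open Scope ring_scope.

(** * Real norms and real inner products *)

Section real_norm.
Context {R : realType} {V : normedModType R[i]}.
Implicit Types (u v : V) (c : R).

Definition rnorm v : R := complex.Re `|v|.

Lemma rnormE v : (rnorm v)%:C = `|v|.
Proof. by rewrite /rnorm RRe_real// ger0_real. Qed.

Lemma rnorm_ge0 v : 0 <= rnorm v.
Proof. by rewrite -ler0c rnormE. Qed.

Lemma rnorm0 : rnorm 0 = 0.
Proof. by apply: complexI; rewrite rnormE normr0. Qed.

Lemma rnormN v : rnorm (- v) = rnorm v.
Proof. by rewrite /rnorm normrN. Qed.

Lemma rnorm_distC u v : rnorm (u - v) = rnorm (v - u).
Proof. by rewrite /rnorm distrC. Qed.

Lemma ler_rnormD u v : rnorm (u + v) <= rnorm u + rnorm v.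
Proof. by rewrite -lecR rmorphD/= !rnormE ler_normD. Qed.

Lemma ler_rnormB u v : rnorm (u - v) <= rnorm u + rnorm v.
Proof. by rewrite -(rnormN v) ler_rnormD. Qed.

Lemma ler_rnorm_distD w u v : rnorm (u - v) <= rnorm (u - w) + rnorm (w - v).
Proof. by rewrite -(subrKA w) ler_rnormD. Qed.

Lemma ler_dist_rnorm u v : `|rnorm u - rnorm v| <= rnorm (u - v).
Proof.
have le_rnorm w w' : rnorm w - rnorm w' <= rnorm (w - w').
  by rewrite lerBlDr -{1}(subrK w' w) ler_rnormD.
by rewrite ler_norml le_rnorm andbT lerNl opprB rnorm_distC le_rnorm.
Qed.

Lemma rnormZr c v : rnorm (c%:C *: v) = `|c| * rnorm v.
Proof.
apply: complexI; rewrite rnormE normrZ -rnormE rmorphM normc_def/=.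
by rewrite expr0n/= addr0 sqrtr_sqr.
Qed.

Lemma rnorm_eq0 v : (rnorm v == 0) = (v == 0).
Proof. by rewrite -[RHS]normr_eq0 -rnormE -(inj_eq (@complexI R)). Qed.

Lemma rnorm_gt0 v : (0 < rnorm v) = (v != 0).
Proof. by rewrite lt_def rnorm_ge0 andbT rnorm_eq0. Qed.

Lemma rnorm_normalize v : v != 0 -> rnorm ((rnorm v)^-1%:C *: v) = 1.
Proof.
move=> v0; rewrite rnormZr ger0_norm ?invr_ge0 ?rnorm_ge0// mulVf//.
by rewrite rnorm_eq0.
Qed.

Lemma cvg_rnormP {T : Type} {F : set_system T} {FF : Filter F} (f : T -> V) v :
  f x @[x --> F] --> v <-> rnorm (v - f x) @[x --> F] --> (0 : R).
Proof.
split=> /cvgrPdist_lt fv; apply/cvgrPdist_lt => e e0.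
  have /fv : 0 < e%:C by rewrite ltcR.
  apply: filterS => x; rewrite -rnormE ltcR.
  by rewrite sub0r normrN ger0_norm ?rnorm_ge0.
have eE : e = (complex.Re e)%:C by rewrite RRe_real// gtr0_real.
have /fv : 0 < complex.Re e by rewrite -ltcR -eE.
apply: filterS => x; rewrite sub0r normrN ger0_norm ?rnorm_ge0//.
by rewrite -rnormE [in X in _ -> X]eE ltcR.
Qed.

Lemma cvg_rnorm_squeeze {T : Type} {F : set_system T} {FF : Filter F} (f : T -> V)
    v (b : T -> R) : (\forall x \near F, rnorm (v - f x) <= b x) ->
  b x @[x --> F] --> 0 -> f x @[x --> F] --> v.
Proof.
move=> fb b0; apply/cvg_rnormP; apply: squeeze_cvgr (cvg_cst 0) b0.
by apply: filterS fb => x; rewrite rnorm_ge0.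
Qed.

Lemma cvg_rnorm {T : Type} {F : set_system T} {FF : Filter F} (f : T -> V) v :
  f x @[x --> F] --> v -> rnorm (f x) @[x --> F] --> rnorm v.
Proof.
move=> /cvg_rnormP/cvgrPdist_lt fv; apply/cvgrPdist_lt => e /fv.
apply: filterS => x; rewrite sub0r normrN ger0_norm ?rnorm_ge0//.
exact: le_lt_trans (ler_dist_rnorm _ _).
Qed.

Lemma cvg_rnorm_le {T : Type} {F : set_system T} {FF : ProperFilter F}
    (f : T -> V) v (M : R) : f x @[x --> F] --> v ->
  (\forall x \near F, rnorm (f x) <= M) -> rnorm v <= M.
Proof. by move=> /cvg_rnorm; exact: cvgr_to_le. Qed.

End real_norm.

Lemma rnorm_cauchy_cvg {R : realType} {V : completeNormedModType R[i]}
    (x : nat -> V) (a : nat -> R) : a @ \oo --> 0 ->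
  (forall n m, rnorm (x n - x m) <= a n + a m) -> exists v : V, x @ \oo --> v.
Proof.
move=> /cvgrPdist_lt a0 xa; exists (lim (x @ \oo)).
apply/cauchy_cvgP/cauchy_ballP => e e0.
have eE : e = (complex.Re e)%:C by rewrite RRe_real// gtr0_real.
have e20 : 0 < complex.Re e / 2 by rewrite divr_gt0// -ltcR -eE.
have {}a0 : \forall n \near \oo, a n < complex.Re e / 2.
  by apply: filterS (a0 _ e20) => n; rewrite sub0r normrN => /ltr_normlW.
rewrite near_map2; near=> n m => /=; rewrite -ball_normE/= -rnormE eE ltcR.
rewrite (le_lt_trans (xa _ _))// (splitr (complex.Re e)) ltrD//.
  by near: n; exact: a0.
by near: m; exact: a0.
Unshelve. all: by end_near. Qed.

Section real_inner_product.
Context {R : realType} {H : hilbertType R}.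
Implicit Types (x y z : H) (c : R).

Definition rdot x y : R := complex.Re (inner x y).

Lemma innerZl (w : R[i]) x y : inner (w *: x) y = w * inner x y.
Proof. exact: linearZl_LR. Qed.

Lemma innerC x y : inner x y = (inner y x)^*.
Proof. by rewrite hermC expr0 mul1r. Qed.

Lemma inner_diag x : inner x x = (rnorm x ^+ 2)%:C.
Proof. by rewrite inner_norm -rnormE -rmorphXn. Qed.

Lemma Im_innerE x y : complex.Im (inner x y) = - rdot ('i *: x) y.
Proof. by rewrite /rdot innerZl; case: (inner x y) => p q /=; ring. Qed.

Lemma rdotC x y : rdot x y = rdot y x.
Proof. by rewrite /rdot innerC; case: (inner y x). Qed.

Lemma rdotDl x y z : rdot (x + y) z = rdot x z + rdot y z.
Proof. by rewrite /rdot linearDl raddfD. Qed.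

Lemma rdotDr x y z : rdot x (y + z) = rdot x y + rdot x z.
Proof. by rewrite !(rdotC x) rdotDl. Qed.

Lemma rdotZl c x y : rdot (c%:C *: x) y = c * rdot x y.
Proof. by rewrite /rdot innerZl; case: (inner x y) => p q /=; ring. Qed.

Lemma rdotZr c x y : rdot x (c%:C *: y) = c * rdot x y.
Proof. by rewrite !(rdotC x) rdotZl. Qed.

Lemma rdotNl x y : rdot (- x) y = - rdot x y.
Proof. by rewrite /rdot linearNl raddfN. Qed.

Lemma rdotNr x y : rdot x (- y) = - rdot x y.
Proof. by rewrite !(rdotC x) rdotNl. Qed.

Lemma rdotBl x y z : rdot (x - y) z = rdot x z - rdot y z.
Proof. by rewrite rdotDl rdotNl. Qed.

Lemma rdotBr x y z : rdot x (y - z) = rdot x y - rdot x z.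
Proof. by rewrite rdotDr rdotNr. Qed.

Lemma rdot_diag x : rdot x x = rnorm x ^+ 2.
Proof. by rewrite /rdot inner_diag. Qed.

Lemma rdot0l x : rdot 0 x = 0.
Proof. by rewrite -(scale0r 0) (rdotZl 0) mul0r. Qed.

Lemma rnormD_sqr x y :
  rnorm (x + y) ^+ 2 = rnorm x ^+ 2 + 2 * rdot x y + rnorm y ^+ 2.
Proof. by rewrite -!rdot_diag !(rdotDl, rdotDr) (rdotC y x); ring. Qed.

Lemma rnormB_sqr x y :
  rnorm (x - y) ^+ 2 = rnorm x ^+ 2 - 2 * rdot x y + rnorm y ^+ 2.
Proof. by rewrite rnormD_sqr rdotNr rnormN; ring. Qed.

(* Expand [0 <= | |y| x - |x| y |^2]. *)
Lemma ler_rdot x y : rdot x y <= rnorm x * rnorm y.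
Proof.
have [->|x0] := eqVneq x 0; first by rewrite rdot0l rnorm0 mul0r.
have [->|y0] := eqVneq y 0; first by rewrite rdotC rdot0l rnorm0 mulr0.
have xy0 : 0 < rnorm x * rnorm y by rewrite mulr_gt0 ?rnorm_gt0.
have := sqr_ge0 (rnorm ((rnorm y)%:C *: x - (rnorm x)%:C *: y)).
rewrite rnormB_sqr !rnormZr !(ger0_norm (rnorm_ge0 _)) rdotZl rdotZr.
by move=> expanded; rewrite -(ler_pM2l xy0); lra.
Qed.

Lemma ler_norm_rdot x y : `|rdot x y| <= rnorm x * rnorm y.
Proof.
by rewrite ler_norml ler_rdot andbT lerNl -rdotNl (le_trans (ler_rdot _ _))// rnormN.
Qed.

End real_inner_product.

(** * Bounded operators *)

Section bounded_operators.
Context {R : realType} {H : hilbertType R}.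
Implicit Types (A B T X : 'B(H)) (x y : H) (c M : R).

Lemma ler_rnorm_op A x : rnorm (A x) <= rnorm A * rnorm x.
Proof.
have [->|x0] := eqVneq x 0; first by rewrite linear0 !rnorm0 mulr0.
have x_gt0 : 0 < rnorm x by rewrite rnorm_gt0.
have := @opnorm_ub R H A ((rnorm x)^-1%:C *: x).
rewrite linearZ -!rnormE rnorm_normalize// !rnormZr !lecR.
by rewrite gtr0_norm ?invr_gt0// mulrC ler_pdivrMr//; exact.
Qed.

Lemma rnorm_op_le A M : 0 <= M -> (forall x, rnorm (A x) <= M * rnorm x) ->
  rnorm A <= M.
Proof.
move=> M0 AM; apply: opnorm_le => x; rewrite -!rnormE.
by rewrite (_ : 1 = 1%:C)// !lecR => x1; rewrite (le_trans (AM x))// ler_piMr.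
Qed.

Lemma rnorm_op1_le1 : rnorm (1 : 'B(H)) <= 1.
Proof. by apply: rnorm_op_le => // x; rewrite mul1r. Qed.

Lemma ler_rnorm_opM A B : rnorm (A * B) <= rnorm A * rnorm B.
Proof.
apply: rnorm_op_le => [|x]; first by rewrite mulr_ge0 ?rnorm_ge0.
rewrite -mulrA; apply: le_trans (ler_rnorm_op A (B x)) _.
by rewrite ler_wpM2l ?rnorm_ge0// ler_rnorm_op.
Qed.

Lemma ler_rnorm_opX A n : rnorm (A ^+ n) <= rnorm A ^+ n.
Proof.
elim: n => [|n ih]; first by rewrite !expr0 rnorm_op1_le1.
rewrite !exprS (le_trans (ler_rnorm_opM _ _))//.
by rewrite ler_wpM2l ?rnorm_ge0.
Qed.

Lemma bop_uniform_limit (F : set_system 'B(H)) (T : H -> H) : ProperFilter F ->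
  (forall e, 0 < e ->
    \forall A \near F, forall x, rnorm (T x - bop_fun A x) <= e * rnorm x) ->
  cvg F.
Proof.
move=> FF FT.
have FTx x : bop_fun A x @[A --> F] --> T x.
  apply/cvg_rnormP/cvgrPdist_le => e e0.
  have x1 : 0 < rnorm x + 1 by rewrite ltr_wpDl ?rnorm_ge0.
  apply: filterS (FT _ (divr_gt0 e0 x1)) => A /(_ x) TA.
  rewrite sub0r normrN ger0_norm ?rnorm_ge0// (le_trans TA)// mulrAC.
  by rewrite ler_pdivrMr// ler_wpM2l ?(ltW e0)// lerDl.
have T_linear : linear T.
  move=> k x y; apply: (cvg_unique _ (FTx _)) => //.
  have AP : (fun A : 'B(H) => A (k *: x + y)) =1 (fun A => k *: A x + A y).
    by move=> A; rewrite linearP.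
  by rewrite (funext AP); apply: cvgD; [apply: cvgZr|]; exact: FTx.
have T_bounded : T \in bounded_linear_pred.
  apply/bounded_linearP; split=> //.
  have [A TA] := filter_ex (FT 1 ltr01); exists (1 + rnorm A)%:C => x.
  rewrite -!rnormE -rmorphM lecR mulrDl -(subrK (A x) (T x)).
  by rewrite (le_trans (ler_rnormD _ _))// lerD// ler_rnorm_op.
apply/cvg_ex; exists (Bop T_bounded); apply/cvg_rnormP/cvgrPdist_le => e e0.
apply: filterS (FT e e0) => A TA; rewrite sub0r normrN ger0_norm ?rnorm_ge0//.
by apply: rnorm_op_le => [|x]; [exact: ltW|exact: TA].
Qed.

Lemma bop_cauchy_cvg (F : set_system 'B(H)) :
  ProperFilter F -> cauchy F -> cvg F.
Proof.
move=> FF /cauchy_ballP cF.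
have {}cF e : 0 < e -> \forall A \near F & B \near F, rnorm (A - B) < e.
  move=> e0; have /cF : 0 < e%:C by rewrite ltcR.
  by apply: filterS => -[A B] /=; rewrite -ball_normE/= -rnormE ltcR.
pose T x := lim (bop_fun A x @[A --> F]).
have FT x : bop_fun A x @[A --> F] --> T x.
  apply/cauchy_cvgP/(cauchy_ballP (bop_fun A x @[A --> F])) => e e0.
  have eE : e = (complex.Re e)%:C by rewrite RRe_real// gtr0_real.
  have x1 : 0 < rnorm x + 1 by rewrite ltr_wpDl ?rnorm_ge0.
  have ex0 : 0 < complex.Re e / (rnorm x + 1) by rewrite divr_gt0// -ltcR -eE.
  rewrite near_map2; apply: filterS (cF _ ex0) => -[A B] /= AB.
  rewrite -ball_normE/= -rnormE eE ltcR; move: AB; rewrite ltr_pdivlMr//.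
  apply: le_lt_trans; apply: le_trans (ler_rnorm_op (A - B) x) _.
  by rewrite ler_wpM2l ?rnorm_ge0// lerDl.
apply: (@bop_uniform_limit _ T) => e /cF/nearP_dep; apply: filterS => A FA x.
apply: (@cvg_rnorm_le _ _ _ F _ (fun B => B x - A x)).
  by apply: cvgB; [exact: FT|exact: cvg_cst].
apply: filterS FA => B AB; apply: le_trans (ler_rnorm_op (B - A) x) _.
by rewrite ler_wpM2r ?rnorm_ge0// rnorm_distC ltW.
Qed.

HB.instance Definition _ := Uniform_isComplete.Build 'B(H) bop_cauchy_cvg.

Definition invertible A := exists B, B * A = 1 /\ A * B = 1.

Lemma invertible_scale (w : R[i]) A :
  w != 0 -> invertible (w *: A) -> invertible A.
Proof.
move=> w0 [B [BA AB]]; exists (w *: B); split; apply: bopP => x.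
  rewrite -BA; change (w *: B (A x) = B (w *: A x)).
  by rewrite linearZ.
rewrite -AB; change (A (w *: B x) = w *: A (B x)).
by rewrite linearZ.
Qed.

Section neumann_series.
Variable X : 'B(H).
Hypothesis X1 : rnorm X < 1.

Let S n := \sum_(i < n) X ^+ i.

Let q := (1 - rnorm X)^-1.

Let rnorm_S n : rnorm (S n) <= q.
Proof.
have p0 : 0 < 1 - rnorm X by rewrite subr_gt0.
have geometric : (1 - rnorm X) * \sum_(i < n) rnorm X ^+ i = 1 - rnorm X ^+ n.
  by rewrite -opprB mulNr -subrX1 opprB.
have S_le : rnorm (S n) <= \sum_(i < n) rnorm X ^+ i.
  apply: (big_ind2 (fun A r => rnorm A <= r)) => [|A r B s Ar Bs|i _].
  - by rewrite rnorm0.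
  - by rewrite (le_trans (ler_rnormD _ _))// lerD.
  - exact: ler_rnorm_opX.
rewrite (le_trans S_le)// /q -[leRHS]mul1r ler_pdivlMr// mulrC geometric.
by rewrite gerBl exprn_ge0 ?rnorm_ge0.
Qed.

Let rnorm_S_dist n m :
  rnorm (S n - S m) <= q * rnorm X ^+ n + q * rnorm X ^+ m.
Proof.
wlog mn : n m / (m <= n)%N.
  move=> wlog_mn; case: (leqP m n) => [|/ltnW] mn; first exact: wlog_mn.
  by rewrite rnorm_distC [leRHS]addrC; exact: wlog_mn.
have S_addn k : S (m + k) = S m + X ^+ m * S k.
  rewrite /S big_split_ord/= mulr_sumr; congr (_ + _).
  by apply: eq_bigr => i _; rewrite exprD.
rewrite -(subnKC mn) S_addn addrAC subrr add0r.
apply: le_trans (ler_rnorm_opM _ _) _; rewrite mulrC.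
have q0 : 0 <= q by rewrite invr_ge0 subr_ge0 ltW.
rewrite -[leLHS]add0r lerD ?mulr_ge0 ?exprn_ge0 ?rnorm_ge0//.
by rewrite ler_pM ?rnorm_ge0 ?ler_rnorm_opX// rnorm_S.
Qed.

Lemma neumann_invertible : invertible (1 - X).
Proof.
have Xn0 : (fun n => rnorm X ^+ n) @ \oo --> 0.
  by apply: cvg_expr; rewrite ger0_norm ?rnorm_ge0.
have [B SB] : exists B : 'B(H), S @ \oo --> B.
  apply: rnorm_cauchy_cvg rnorm_S_dist.
  by rewrite -(mulr0 q); apply: cvgM => //; exact: cvg_cst.
have {SB} BS0 : (fun n => rnorm (1 - X) * rnorm (B - S n) + rnorm X ^+ n)
    @ \oo --> 0.
  rewrite -[0]addr0 -{1}(mulr0 (rnorm (1 - X))); apply: cvgD => //.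
  by apply: cvgM; [exact: cvg_cst|exact/cvg_rnormP].
have lim1 (A : 'B(H)) : (forall n, rnorm (A - (1 - X ^+ n)) <=
    rnorm (1 - X) * rnorm (B - S n)) -> A = 1.
  move=> A1; apply/eqP; rewrite -subr_eq0 -rnorm_eq0; apply/eqP/le_anti.
  rewrite rnorm_ge0 andbT; apply: (cvgr_to_ge BS0); apply: nearW => n.
  apply: le_trans (ler_rnorm_distD (1 - X ^+ n) _ _) _.
  by rewrite lerD// addrAC subrr add0r rnormN ler_rnorm_opX.
have X_S n : (1 - X) * S n = 1 - X ^+ n.
  by rewrite -opprB mulNr -subrX1 opprB.
have S_X n : S n * (1 - X) = 1 - X ^+ n.
  rewrite -X_S mulrBl mulrBr mul1r mulr1 mulr_suml mulr_sumr.
  by congr (_ - _); apply: eq_bigr => i _; rewrite -exprS -exprSr.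
exists B; split; apply: lim1 => n; [rewrite -S_X -mulrBl mulrC|rewrite -X_S -mulrBr].
  exact: ler_rnorm_opM.
exact: ler_rnorm_opM.
Qed.

End neumann_series.

End bounded_operators.

Section quadratic_form.
Context {R : realType} {H : hilbertType R}.
Implicit Types (A B : 'B(H)) (x : H) (c : R).

Definition qform A x : R := rdot (A x) x.

Lemma qformD A B x : qform (A + B) x = qform A x + qform B x.
Proof. by rewrite /qform bopDE rdotDl. Qed.

Lemma qformN A x : qform (- A) x = - qform A x.
Proof. by rewrite /qform bopNE rdotNl. Qed.

Lemma qformB A B x : qform (A - B) x = qform A x - qform B x.
Proof. by rewrite qformD qformN. Qed.

Lemma qformZ c A x : qform (c%:C *: A) x = c * qform A x.
Proof. by rewrite /qform bopZE rdotZl. Qed.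

Lemma qform1 x : qform 1 x = rnorm x ^+ 2.
Proof. exact: rdot_diag. Qed.

Lemma qform_nabla c A B x :
  qform (nabla c A B) x = (1 - c) * qform A x + c * qform B x.
Proof. by rewrite /nabla qformD !qformZ. Qed.

Lemma qform_scale A c x : qform A (c%:C *: x) = c ^+ 2 * qform A x.
Proof. by rewrite /qform linearZ rdotZl rdotZr mulrA. Qed.

Lemma qform_normalize A x : x != 0 ->
  qform A ((rnorm x)^-1%:C *: x) = qform A x / rnorm x ^+ 2.
Proof. by move=> x0; rewrite qform_scale mulrC exprVn. Qed.

Lemma ler_norm_qform A x : `|qform A x| <= rnorm A * rnorm x ^+ 2.
Proof.
rewrite (le_trans (ler_norm_rdot _ _))// expr2 mulrA ler_wpM2r ?rnorm_ge0//.
exact: ler_rnorm_op.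
Qed.

End quadratic_form.

Section self_adjoint.
Context {R : realType} {H : hilbertType R}.
Implicit Types (A B S T : 'B(H)) (x y : H) (c : R).

Lemma self_adjointP A :
  self_adjoint A <-> forall x y, rdot (A x) y = rdot x (A y).
Proof.
split=> [sA x y|sA x y]; first by rewrite /rdot sA.
apply/eqP; rewrite eq_complex; apply/andP; split; apply/eqP; first exact: sA.
by rewrite !Im_innerE -linearZ sA.
Qed.

Lemma self_adjoint0 : self_adjoint (0 : 'B(H)).
Proof. by move=> x y; rewrite !bop0E linear0l linear0r. Qed.

Lemma self_adjointD A B : self_adjoint A -> self_adjoint B -> self_adjoint (A + B).
Proof. by move=> sA sB x y; rewrite !bopDE linearDl linearDr/= sA sB. Qed.

Lemma self_adjointZ c A : self_adjoint A -> self_adjoint (c%:C *: A).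
Proof.
move=> /self_adjointP sA; apply/self_adjointP => x y.
by rewrite !bopZE rdotZl rdotZr sA.
Qed.

Lemma self_adjointN A : self_adjoint A -> self_adjoint (- A).
Proof. by move=> sA x y; rewrite !bopNE linearNl linearNr/= sA. Qed.

Lemma self_adjointB A B : self_adjoint A -> self_adjoint B -> self_adjoint (A - B).
Proof. by move=> sA sB; apply: self_adjointD => //; exact: self_adjointN. Qed.

Lemma self_adjointX A n : self_adjoint A -> self_adjoint (A ^+ n).
Proof.
move=> sA; elim: n => [//|n sAn] x y; rewrite {1}exprS exprSr.
by change (inner (A ((A ^+ n) x)) y = inner x ((A ^+ n) (A y))); rewrite sA sAn.
Qed.

Lemma self_adjoint_nabla c A B :
  self_adjoint A -> self_adjoint B -> self_adjoint (nabla c A B).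
Proof. by move=> sA sB; apply: self_adjointD; exact: self_adjointZ. Qed.

Lemma cvg_rdotl {T : Type} {F : set_system T} {FF : Filter F} (f : T -> H) x y :
  f t @[t --> F] --> x -> rdot (f t) y @[t --> F] --> rdot x y.
Proof.
move=> /cvg_rnormP fx; apply/cvgrPdist_le => e e0.
have : rnorm (x - f t) * rnorm y @[t --> F] --> 0.
  by rewrite -(mul0r (rnorm y)); apply: cvgM => //; exact: cvg_cst.
move=> /cvgrPdist_le/(_ _ e0); apply: filterS => t.
rewrite sub0r normrN ger0_norm ?mulr_ge0 ?rnorm_ge0//; apply: le_trans.
by rewrite -rdotBl ler_norm_rdot.
Qed.

Lemma cvg_bop_app {T : Type} {F : set_system T} {FF : Filter F} (X : T -> 'B(H)) A x :
  X t @[t --> F] --> A -> bop_fun (X t) x @[t --> F] --> bop_fun A x.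
Proof.
move=> /cvg_rnormP XA; apply: (@cvg_rnorm_squeeze _ _ _ F _ _ _
  (fun t => rnorm (A - X t) * rnorm x)).
  by apply: nearW => t; exact: ler_rnorm_op (A - X t) x.
by rewrite -(mul0r (rnorm x)); apply: cvgM => //; exact: cvg_cst.
Qed.

Lemma self_adjoint_lim {T : Type} {F : set_system T} {FF : ProperFilter F}
    (X : T -> 'B(H)) A : (forall t, self_adjoint (X t)) ->
  X t @[t --> F] --> A -> self_adjoint A.
Proof.
move=> sX XA; apply/self_adjointP => x y.
have cvgA u v : rdot (X t u) v @[t --> F] --> rdot (A u) v.
  by apply: cvg_rdotl; exact: cvg_bop_app.
apply: (cvg_unique _ (cvgA x y)) => //; rewrite rdotC.
have XE : (fun t => rdot (X t x) y) =1 (fun t => rdot (X t y) x).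
  by move=> t; have /self_adjointP -> := sX t; rewrite rdotC.
by rewrite (funext XE); exact: cvgA.
Qed.

Lemma self_adjoint_horner (p : {poly R}) A :
  self_adjoint A -> self_adjoint (op_horner p A).
Proof.
move=> sA; rewrite /op_horner; apply: big_ind => [||i _].
- exact: self_adjoint0.
- exact: self_adjointD.
- by apply: self_adjointZ; exact: self_adjointX.
Qed.

Lemma self_adjoint_cfc (f : R -> R) A : self_adjoint A -> self_adjoint (cfc f A).
Proof.
move=> sA; rewrite /cfc; case: xgetP => [T -> [p _ pT]|_].
  by apply: self_adjoint_lim pT => n; exact: self_adjoint_horner.
exact: self_adjoint0.
Qed.

Lemma self_adjoint_inner A x : self_adjoint A -> inner (A x) x = (qform A x)%:C.
Proof.
move=> sA; apply/eqP; rewrite eq_complex/= eqxx/=; apply/eqP.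
have := innerC (A x) x; rewrite -sA; case: (inner _ _) => p q /= [].
by move=> /eqP; rewrite -subr_eq0 opprK -mulr2n mulrn_eq0/= => /eqP.
Qed.

Lemma op_leP A B : self_adjoint A -> self_adjoint B ->
  A <=op B <-> forall x, qform A x <= qform B x.
Proof.
move=> sA sB; have sBA := self_adjointB sB sA.
have BA x : (0 <= inner ((B - A) x) x) = (qform A x <= qform B x).
  by rewrite self_adjoint_inner// lecR qformB subr_ge0.
by split=> AB x; have := AB x; rewrite BA.
Qed.

Lemma self_adjoint_polarization S x y : self_adjoint S ->
  4 * rdot (S x) y = qform S (x + y) - qform S (x - y).
Proof.
move=> /self_adjointP sS; rewrite /qform linearD linearB.
rewrite !(rdotDl, rdotDr, rdotBl, rdotBr, rdotNl, rdotNr).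
by rewrite (sS y x) (rdotC y (S x)); ring.
Qed.

(* Polarization applied to [x] and [y = k^-1 S x]; the slack [e] only serves to
   make [k] positive. *)
Lemma self_adjoint_rnorm_le S c : self_adjoint S -> 0 <= c ->
  (forall x, `|qform S x| <= c * rnorm x ^+ 2) -> rnorm S <= c.
Proof.
move=> sS c0 Sc; apply/ler_addgt0Pr => e e0; set k := c + e.
have k0 : 0 < k by rewrite ltr_wpDl.
apply: rnorm_op_le => [|x]; first exact: ltW.
have {Sc} Sk z : `|qform S z| <= k * rnorm z ^+ 2.
  by rewrite (le_trans (Sc z))// ler_wpM2r ?sqr_ge0// lerDl ltW.
set y : H := (k^-1)%:C *: S x.
have : 4 * rdot (S x) y <= 2 * k * (rnorm x ^+ 2 + rnorm y ^+ 2).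
  rewrite self_adjoint_polarization//; have := Sk (x + y); have := Sk (x - y).
  rewrite !(rnormD_sqr x y) !(rnormB_sqr x y) !ler_norml.
  by move=> /andP[qB _] /andP[_ qD]; lra.
rewrite rdotZr rdot_diag rnormZr ger0_norm ?invr_ge0 ?(ltW k0)// !exprMn.
set s := rnorm (S x) ^+ 2; set t := rnorm x ^+ 2 => st.
rewrite -(ler_pXn2r (n := 2)) ?nnegrE ?mulr_ge0 ?rnorm_ge0 ?(ltW k0)// exprMn.
rewrite -/s -/t; move: st.
have -> : 4 * (k^-1 * s) = (4 * s) / k by field; rewrite gt_eqF.
have -> : 2 * k * (t + k^-1 ^+ 2 * s) = (2 * (k ^+ 2 * t + s)) / k.
  by field; rewrite gt_eqF.
by rewrite ler_pM2r ?invr_gt0//; lra.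
Qed.

End self_adjoint.

(** * The spectrum and the numerical range *)

Lemma is_interval_convex {R : realType} (I : set R) a b t : is_interval I ->
  I a -> I b -> 0 <= t <= 1 -> I ((1 - t) * a + t * b).
Proof.
move=> itvI Ia Ib /andP[t0 t1]; have [ab|/ltW ba] := leP a b.
  by apply: itvI Ia Ib _ _; apply/andP; split; nra.
by apply: itvI Ib Ia _ _; apply/andP; split; nra.
Qed.

Section spectrum.
Context {R : realType} {H : hilbertType R}.
Implicit Types (A B C P T : 'B(H)) (x : H) (c m M : R).

(* Lax-Milgram: for small [e > 0], [1 - e T] has norm less than 1. *)
Lemma coercive_invertible T c : 0 < c ->
  (forall x, c * rnorm x ^+ 2 <= qform T x) -> invertible T.
Proof.
move=> c0 coercive; pose n := rnorm T + c.
have n0 : 0 < n by rewrite ltr_wpDl ?rnorm_ge0.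
pose e := c / n ^+ 2; have e0 : 0 < e by rewrite divr_gt0// exprn_gt0.
have ec_ge0 : 0 <= 1 - e * c.
  rewrite subr_ge0 /e mulrAC ler_pdivrMr ?exprn_gt0// mul1r -expr2.
  by rewrite ler_pXn2r ?nnegrE ?(ltW c0) ?(ltW n0)// lerDr rnorm_ge0.
have contracts x : rnorm (x - e%:C *: T x) <= Num.sqrt (1 - e * c) * rnorm x.
  rewrite -(ler_pXn2r (n := 2)) ?nnegrE ?mulr_ge0 ?rnorm_ge0 ?sqrtr_ge0//.
  rewrite exprMn sqr_sqrtr// rnormB_sqr rnormZr (gtr0_norm e0) rdotZr rdotC.
  have Tn : rnorm (T x) ^+ 2 <= n ^+ 2 * rnorm x ^+ 2.
    rewrite -exprMn ler_pXn2r ?nnegrE ?mulr_ge0 ?rnorm_ge0 ?(ltW n0)//.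
    rewrite (le_trans (ler_rnorm_op T x))// ler_wpM2r ?rnorm_ge0//.
    by rewrite lerDl ltW.
  have : (e * rnorm (T x)) ^+ 2 <= e * c * rnorm x ^+ 2.
    have -> : e * c = e ^+ 2 * n ^+ 2 by rewrite /e; field; rewrite gt_eqF.
    by rewrite exprMn -[leRHS]mulrA ler_wpM2l ?sqr_ge0.
  have : e * (c * rnorm x ^+ 2) <= e * rdot (T x) x by rewrite ler_pM2l.
  by lra.
apply: (@invertible_scale _ _ e%:C).
  by rewrite (inj_eq (@complexI R)) gt_eqF.
rewrite -[X in invertible X](subKr 1); apply: neumann_invertible.
apply: (@le_lt_trans _ _ (Num.sqrt (1 - e * c))).
  by apply: rnorm_op_le => [|x]; [exact: sqrtr_ge0|exact: contracts].
by rewrite -[ltRHS]sqrtr1 ltr_sqrt// gtrBl mulr_gt0.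
Qed.

(* The form of [i q (C - (p + i q))] is [q ^ 2 |x| ^ 2]. *)
Lemma spectrum_real C (z : R[i]) :
  self_adjoint C -> spectrum C z -> complex.Im z = 0.
Proof.
case: z => p q /= sC Cz; apply/eqP/negPn/negP => q0; apply: Cz.
apply: (@invertible_scale _ _ (0 +i* q)).
  by rewrite eq_complex/= negb_and q0 orbT.
apply: (@coercive_invertible _ (q ^+ 2)); first by rewrite exprn_even_gt0.
move=> x; rewrite /qform /rdot !(bopZE, bopDE, bopNE) innerZl linearBl/=.
rewrite innerZl inner_diag self_adjoint_inner//= le_eqVlt.
by apply/orP; left; apply/eqP; ring.
Qed.

Lemma spectrum_ge C m p : (forall x, m * rnorm x ^+ 2 <= qform C x) ->
  spectrum C p%:C -> m <= p.
Proof.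
move=> Cm; rewrite leNgt => Cp; apply/negP => pm; apply: Cp.
apply: (@coercive_invertible _ (m - p)); first by rewrite subr_gt0.
by move=> x; rewrite qformB qformZ qform1 mulrBl lerB.
Qed.

Lemma spectrumN A (z : R[i]) : spectrum A z -> spectrum (- A) (- z).
Proof.
move=> Az [B [BA AB]]; apply: Az; exists (- B).
have opp : A - z *: (1 : 'B(H)) = - (- A - - z *: (1 : 'B(H))).
  by rewrite scaleNr opprB opprK addrC.
by rewrite opp !mulrNN.
Qed.

Lemma spectrum_le C M p : (forall x, qform C x <= M * rnorm x ^+ 2) ->
  spectrum C p%:C -> p <= M.
Proof.
move=> CM /spectrumN; rewrite -rmorphN -lerN2; apply: spectrum_ge => x.
by rewrite qformN mulNr lerN2.
Qed.

(* Evaluate the form at [x - c^-1 P x]. *)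
Lemma nonneg_rnorm_sqr_le P c x : self_adjoint P -> 0 < c -> rnorm P <= c ->
  (forall z, 0 <= qform P z) -> rnorm (P x) ^+ 2 <= c * qform P x.
Proof.
move=> /self_adjointP sP c0 Pc P0; have := P0 (x - (c^-1)%:C *: P x).
rewrite /qform linearB linearZ !(rdotBl, rdotBr, rdotZl, rdotZr).
rewrite (sP (P x) x) rdot_diag.
have : rdot (P (P x)) (P x) <= c * rnorm (P x) ^+ 2.
  apply: le_trans (ler_norm _) _; apply: le_trans (ler_norm_qform P (P x)) _.
  by rewrite ler_wpM2r ?sqr_ge0.
set u := rdot _ (P x); set s := rnorm _ ^+ 2; set t := rdot _ x => us.
have : c^-1 * (c^-1 * u) <= c^-1 * s by rewrite ler_pM2l ?invr_gt0// ler_pdivrMl.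
by move=> us' P_ge0; rewrite -ler_pdivrMl//; lra.
Qed.

Lemma nonneg_invertible_coercive P : self_adjoint P ->
  (forall x, 0 <= qform P x) -> invertible P ->
  exists2 c, 0 < c & forall x, c * rnorm x ^+ 2 <= qform P x.
Proof.
move=> sP P0 [B [BP _]]; pose n := rnorm P + 1.
have n0 : 0 < n by rewrite ltr_wpDl ?rnorm_ge0.
pose k := rnorm B ^+ 2 * n + 1.
have k0 : 0 < k by rewrite ltr_wpDl// mulr_ge0 ?sqr_ge0// ltW.
exists k^-1 => [|x]; first by rewrite invr_gt0.
rewrite ler_pdivrMl//; apply: (@le_trans _ _ (rnorm B ^+ 2 * rnorm (P x) ^+ 2)).
  rewrite -exprMn ler_pXn2r ?nnegrE ?mulr_ge0 ?rnorm_ge0//.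
  have BPx : B (P x) = x := congr1 (bop_fun ^~ x) BP.
  by rewrite -{1}BPx ler_rnorm_op.
have Pn : rnorm P <= n by rewrite lerDl.
rewrite (le_trans (ler_wpM2l (sqr_ge0 _) (nonneg_rnorm_sqr_le x sP n0 Pn P0)))//.
by rewrite mulrA ler_wpM2r// lerDl.
Qed.

Definition qform_inf C : R := inf [set qform C x | x in [set x | rnorm x = 1]].

Lemma qform_inf_lb C x : qform_inf C * rnorm x ^+ 2 <= qform C x.
Proof.
have [->|x0] := eqVneq x 0.
  by rewrite rnorm0 expr0n mulr0 /qform linear0 rdot0l.
rewrite -ler_pdivlMr ?exprn_gt0 ?rnorm_gt0// -qform_normalize//.
apply: ge_inf; last by exists ((rnorm x)^-1%:C *: x); rewrite /= ?rnorm_normalize.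
exists (- rnorm C) => _ [y /= y1 <-]; have := ler_norm_qform C y.
by rewrite y1 expr1n mulr1 ler_norml => /andP[].
Qed.

Lemma spectrum_qform_inf C : (exists x : H, x != 0) -> self_adjoint C ->
  spectrum C (qform_inf C)%:C.
Proof.
move=> [x x0] sC; set m := qform_inf C; set P := C - m%:C *: (1 : 'B(H)) => Pinv.
have PE y : qform P y = qform C y - m * rnorm y ^+ 2.
  by rewrite qformB qformZ qform1.
have sP : self_adjoint P by apply: self_adjointB => //; exact: self_adjointZ.
have [|c c0 Pc] := nonneg_invertible_coercive sP _ Pinv.
  by move=> y; rewrite PE subr_ge0 qform_inf_lb.
have : m + c <= m.
  apply: lb_le_inf => [|_ [y /= y1 <-]].
    by eexists; eexists; [exact: rnorm_normalize x0|].
  by have := Pc y; rewrite PE y1 expr1n !mulr1 lerBrDl addrC.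
by rewrite gerDl leNgt c0.
Qed.

Lemma self_adjoint_on_lower_bound (I : set R) A : (exists x : H, x != 0) ->
  self_adjoint_on I A -> exists2 m, I m & forall x, m * rnorm x ^+ 2 <= qform A x.
Proof.
move=> H0 [sA /(_ _ (spectrum_qform_inf H0 sA))[m Im [mE]]].
by exists m => // x; rewrite mE qform_inf_lb.
Qed.

Lemma self_adjoint_on_upper_bound (I : set R) A : (exists x : H, x != 0) ->
  self_adjoint_on I A -> exists2 M, I M & forall x, qform A x <= M * rnorm x ^+ 2.
Proof.
move=> H0 [sA]; have := spectrumN (spectrum_qform_inf H0 (self_adjointN sA)).
rewrite opprK -rmorphN => AM /(_ _ AM)[M IM [ME]].
by exists M => // x; rewrite ME mulNr lerNr -qformN qform_inf_lb.
Qed.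

Lemma spectrum_trivial A : (forall x : H, x = 0) -> spectrum A = set0.
Proof.
move=> H0; apply/seteqP; split=> // z; apply; exists 0.
by split; apply: bopP => x; rewrite (H0 (_ x)) [RHS]H0.
Qed.

Lemma self_adjoint_on_nabla (I : set R) A B (t : R) : is_interval I ->
  self_adjoint_on I A -> self_adjoint_on I B -> 0 <= t <= 1 ->
  self_adjoint_on I (nabla t A B).
Proof.
move=> itvI IA IB t01; have /andP[t0 t1] := t01.
have s0 : 0 <= 1 - t by rewrite subr_ge0.
have sT : self_adjoint (nabla t A B).
  by apply: self_adjoint_nabla; [case: IA|case: IB].
split=> //; have [H0|/forallNP H0] := pselect (exists x : H, x != 0); last first.
  by rewrite spectrum_trivial// => x; apply/eqP/negPn/negP.
have [m Im Am] := self_adjoint_on_lower_bound H0 IA.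
have [n In Bn] := self_adjoint_on_lower_bound H0 IB.
have [M IM AM] := self_adjoint_on_upper_bound H0 IA.
have [N IN BN] := self_adjoint_on_upper_bound H0 IB.
move=> [p q] Tp; have /= q0 := spectrum_real sT Tp; rewrite q0 in Tp *.
exists p => //; apply: (itvI _ _ (is_interval_convex itvI Im In t01)
  (is_interval_convex itvI IM IN t01)).
apply/andP; split; [apply: spectrum_ge Tp|apply: spectrum_le Tp] => x;
  by rewrite qform_nabla (mulrDl _ _ (rnorm x ^+ 2)) -!mulrA lerD// ler_wpM2l.
Qed.

End spectrum.

(** * Convex functions of a real variable *)

Section convex_function_real.
Context {R : realType}.
Implicit Types (D : set R^o) (g : R^o -> R^o) (a b d k l m s t : R).

Lemma convex_functionP D g : convex_function D g <->
  forall s t l, D s -> D t -> 0 <= l <= 1 ->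
    g ((1 - l) * s + l * t) <= (1 - l) * g s + l * g t.
Proof.
split=> [cg s t l Ds Dt /andP[l0 l1]|cg l x y /[!inE] Dx Dy].
  rewrite [X in g X <= _]addrC [leRHS]addrC.
  by apply: (cg (Itv01 l0 l1) t s); rewrite inE.
have l01 : 0 <= l%:num <= 1 by rewrite ge0 le1.
by have := cg y x l%:num Dy Dx l01; rewrite addrC [X in _ <= X]addrC.
Qed.

(* Convexity multiplied through by [t - s], so that no division occurs. *)
Lemma convex_function_barycentre D g s m t : convex_function D g ->
  D s -> D t -> s <= m <= t -> (t - s) * g m <= (t - m) * g s + (m - s) * g t.
Proof.
move=> /convex_functionP cg Ds Dt /andP[sm mt].
have := le_trans sm mt; rewrite le_eqVlt => /predU1P[st|st].
  have -> : m = t by apply/le_anti; rewrite mt -st sm.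
  by rewrite st subrr !mul0r addr0.
have ts0 : 0 < t - s by rewrite subr_gt0.
pose l := (m - s) / (t - s).
have l01 : 0 <= l <= 1.
  by rewrite divr_ge0 ?subr_ge0 ?(ltW st)//= ler_pdivrMr// mul1r lerB.
have mE : m = (1 - l) * s + l * t by rewrite /l; field; rewrite gt_eqF.
have := cg s t l Ds Dt l01; rewrite -mE -(ler_pM2l ts0) => /le_trans; apply.
by rewrite le_eqVlt; apply/orP; left; apply/eqP; rewrite /l; field; rewrite gt_eqF.
Qed.

Lemma convex_function_slope D g s m t : convex_function D g ->
  D s -> D t -> s < m < t -> (g m - g s) / (m - s) <= (g t - g m) / (t - m).
Proof.
move=> cg Ds Dt /andP[sm mt].
have smt : s <= m <= t by rewrite !ltW.
have := convex_function_barycentre cg Ds Dt smt.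
by rewrite ler_pdivrMr ?subr_gt0// mulrAC ler_pdivlMr ?subr_gt0//; lra.
Qed.

Lemma convex_function_support D g a m b : convex_function D g ->
  D a -> D b -> a < m < b ->
  exists k, forall t, D t -> g m + k * (t - m) <= g t.
Proof.
move=> cg Da Db /andP[am mb].
pose S := [set (g m - g s) / (m - s) | s in [set s | D s /\ s < m]].
have S_ub t : D t -> m < t -> ubound S ((g t - g m) / (t - m)).
  move=> Dt mt _ [s [Ds sm] <-]; apply: convex_function_slope cg Ds Dt _.
  by rewrite sm.
have S_sup : has_sup S.
  by split; [eexists; exists a|exists ((g b - g m) / (b - m)); exact: S_ub].
exists (sup S) => t Dt; have [tm|mt|->] := ltgtP t m.
- have : (g m - g t) / (m - t) <= sup S.
    by apply: ub_le_sup; [case: S_sup|exists t].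
  by rewrite ler_pdivrMr ?subr_gt0//; lra.
- have : sup S <= (g t - g m) / (t - m).
    by apply: ge_sup; [case: S_sup|exact: S_ub].
  by rewrite ler_pdivlMr ?subr_gt0//; lra.
- by rewrite subrr mulr0 addr0.
Qed.

Lemma convex_function_bounded a b g t : a < b ->
  convex_function `[a, b]%classic g -> a <= t <= b ->
  `|g t| <= 2 * `|g ((a + b) / 2)| + `|g a| + `|g b|.
Proof.
move=> ab cg atb.
have Dab s : a <= s <= b -> `[a, b]%classic s by rewrite /= in_itv.
have [aab abb] : a <= a <= b /\ a <= b <= b by rewrite !lexx ltW.
have ub s : a <= s <= b -> g s <= `|g a| + `|g b|.
  move=> asb; have ba0 : 0 < b - a by rewrite subr_gt0.
  have := convex_function_barycentre cg (Dab _ aab) (Dab _ abb) asb.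
  move: asb => /andP[sa sb] bary; rewrite -(ler_pM2l ba0) (le_trans bary)//.
  have := ler_norm (g a); have := ler_norm (g b).
  have := normr_ge0 (g a); have := normr_ge0 (g b).
  by move=> *; nra.
have atb' : a <= a + b - t <= b by move: atb => /andP[? ?]; apply/andP; split; lra.
have half : 0 <= (2^-1 : R) <= 1 by apply/andP; split; lra.
have := (convex_functionP _ _).1 cg _ _ 2^-1 (Dab _ atb) (Dab _ atb') half.
have -> : (1 - 2^-1) * t + 2^-1 * (a + b - t) = (a + b) / 2 by field.
have := ub _ atb; have := ub _ atb'.
have := ler_norm (- g ((a + b) / 2)); rewrite normrN.
have := normr_ge0 (g ((a + b) / 2)).
have := normr_ge0 (g a); have := normr_ge0 (g b).
by move=> *; rewrite ler_norml; apply/andP; split; lra.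
Qed.

(* Each of [g s] and [g t] is controlled by the other and by the value of [g] at
   one of [t - d], [t + d], the segment from [t] to [s] being extrapolated. *)
Lemma convex_function_lipschitz D g k d s t : convex_function D g ->
  (forall u, D u -> `|g u| <= k) -> 0 < d -> D (t - d) -> D t -> D (t + d) ->
  D s -> `|t - s| <= d -> `|g t - g s| <= 2 * k * (`|t - s| / d).
Proof.
move=> cg gk d0 DtBd Dt DtDd Ds tsd.
rewrite mulrA ler_pdivlMr// -{1}(gtr0_norm d0) -normrM.
have incr u r : D u -> 0 <= r -> r * (g u - g t) <= 2 * k * r.
  move=> /gk/ler_normlW gu r0; rewrite mulrC ler_wpM2r//.
  by have := ler_norm (- g t); have := gk t Dt; rewrite normrN; lra.
have [st|ts] := leP s t.
  have r0 : 0 <= t - s by rewrite subr_ge0.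
  rewrite (ger0_norm r0) in tsd *.
  have := incr _ _ DtDd r0; have := incr _ _ DtBd r0.
  have : s <= t <= t + d by apply/andP; split; lra.
  move=> /(convex_function_barycentre cg Ds DtDd) bary_t.
  have : t - d <= s <= t by apply/andP; split; lra.
  move=> /(convex_function_barycentre cg DtBd Dt) bary_s.
  by move=> *; rewrite ler_norml; apply/andP; split; lra.
have r0 : 0 <= s - t by rewrite subr_ge0 ltW.
rewrite distrC (ger0_norm r0) in tsd *.
have := incr _ _ DtDd r0; have := incr _ _ DtBd r0.
have : t - d <= t <= s by apply/andP; split; lra.
move=> /(convex_function_barycentre cg DtBd Ds) bary_t.
have : t <= s <= t + d by apply/andP; split; lra.
move=> /(convex_function_barycentre cg Dt DtDd) bary_s.
by move=> *; rewrite ler_norml; apply/andP; split; lra.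
Qed.

Lemma convex_function_measurable D g :
  is_interval D -> convex_function D g -> measurable_fun D g.
Proof.
move=> itvD cg mD; apply: (measurability _ (RGenInftyO.measurableE R)) => //.
move=> _ [_ [c ->] <-]; apply: is_interval_measurable => s t.
rewrite /= !in_itv/= => -[Ds gs] [Dt gt] m smt; split.
  exact: itvD Ds Dt _ smt.
have := convex_function_barycentre cg Ds Dt smt; move: smt => /andP[sm mt].
have [<-//|ms] := eqVneq s m.
have ts0 : 0 < t - s by rewrite subr_gt0 (lt_le_trans _ mt)// lt_neqAle ms.
have ms0 : 0 < m - s by rewrite subr_gt0 lt_neqAle ms.
rewrite in_itv/= -(ltr_pM2l ts0) => /le_lt_trans; apply.
have : (m - s) * g t < (m - s) * c by rewrite ltr_pM2l.
have : (t - m) * g s <= (t - m) * c by rewrite ler_wpM2l ?subr_ge0// ltW.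
by lra.
Qed.

End convex_function_real.

(** * Bochner integrals *)

Lemma bounded_integrable {d} {T : measurableType d} {R : realType}
    (mu : {measure set T -> \bar R}) (D : set T) (f : T -> R) (k : R) :
  measurable D -> (mu D < +oo)%E -> measurable_fun D f ->
  (forall t, D t -> `|f t| <= k) -> mu.-integrable D (EFin \o f).
Proof.
move=> mD muD mf fk; apply: measurable_bounded_integrable => //.
exists k; split; first exact: num_real.
by move=> x kx t Dt; apply: le_trans (fk t Dt) (ltW kx).
Qed.

Lemma ge0_le_integral_nonmeasurable {d} {T : measurableType d} {R : realType}
    (mu : {measure set T -> \bar R}) (D : set T) (f1 f2 : T -> \bar R) :
  (forall t, D t -> 0 <= f1 t)%E -> (forall t, D t -> f1 t <= f2 t)%E ->
  (\int[mu]_(t in D) f1 t <= \int[mu]_(t in D) f2 t)%E.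
Proof.
move=> f10 f12; rewrite !ge0_integralE//; last first.
  by move=> t Dt; rewrite (le_trans (f10 _ Dt)) ?f12.
apply: le_ereal_sup => _ [h /= hf <-]; exists h => //= t.
rewrite (le_trans (hf t))// !patchE; case: ifPn => // /[!inE] Dt.
exact: f12.
Qed.

Section simple_functions.
Context {d} {T : measurableType d} {R : realType} {V : normedModType R[i]}.
Variables (mu : {measure set T -> \bar R}) (D : set T) (mD : measurable D).
Implicit Types (E G : set T) (s : seq (set T * V)) (u v w : V).

Lemma simple_val_cons E v s t :
  simple_val ((E, v) :: s) t = (\1_E t)%:C *: v + simple_val s t.
Proof. by rewrite /simple_val big_cons. Qed.

Lemma simple_int_cons E v s :
  simple_int mu ((E, v) :: s) = (fine (mu E))%:C *: v + simple_int mu s.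
Proof. by rewrite /simple_int big_cons. Qed.

Lemma simple_on_cons E v s : simple_on mu D ((E, v) :: s) ->
  [/\ measurable E, E `<=` D & (mu E < +oo)%E] /\ simple_on mu D s.
Proof.
move=> sEs; split; first exact: (sEs _ (mem_head _ _)).
by move=> Ev Evs; apply: sEs; rewrite inE Evs orbT.
Qed.

Definition simple_opp s := [seq (Ev.1, - Ev.2) | Ev <- s].

Lemma simple_val_opp s t : simple_val (simple_opp s) t = - simple_val s t.
Proof.
rewrite /simple_val big_map -sumrN.
by apply: eq_bigr => Ev _; rewrite scalerN.
Qed.

Lemma simple_int_opp s : simple_int mu (simple_opp s) = - simple_int mu s.
Proof.
rewrite /simple_int big_map -sumrN.
by apply: eq_bigr => Ev _; rewrite scalerN.
Qed.

Lemma simple_on_opp s : simple_on mu D s -> simple_on mu D (simple_opp s).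
Proof. by move=> ss _ /mapP[Ev Evs ->]; exact: (ss Ev Evs). Qed.

Definition simple_sub s1 s2 := s1 ++ simple_opp s2.

Lemma simple_val_sub s1 s2 t :
  simple_val (simple_sub s1 s2) t = simple_val s1 t - simple_val s2 t.
Proof. by rewrite -simple_val_opp /simple_val big_cat. Qed.

Lemma simple_int_sub s1 s2 :
  simple_int mu (simple_sub s1 s2) = simple_int mu s1 - simple_int mu s2.
Proof. by rewrite -simple_int_opp /simple_int big_cat. Qed.

Lemma simple_on_sub s1 s2 : simple_on mu D s1 -> simple_on mu D s2 ->
  simple_on mu D (simple_sub s1 s2).
Proof.
move=> ss1 /simple_on_opp ss2 Ev; rewrite mem_cat => /orP[/ss1|/ss2]; exact.
Qed.

Lemma measurable_simple_val (phi : V -> R) s : simple_on mu D s ->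
  measurable_fun setT (fun t => phi (simple_val s t)).
Proof.
elim: s phi => [|[E v] s ih] phi.
  move=> _; rewrite /simple_val; under eq_fun do rewrite big_nil.
  exact: measurable_cst.
move=> /simple_on_cons[[mE _ _] ss].
have -> : (fun t => phi (simple_val ((E, v) :: s) t)) =
    (fun t => \1_E t * phi (v + simple_val s t)) \+
    (fun t => (1 - \1_E t) * phi (simple_val s t)).
  apply/funext => t; rewrite simple_val_cons /= !indicE; case: (t \in E).
    by rewrite mulr1n scale1r subrr mul0r mul1r addr0.
  by rewrite mulr0n scale0r subr0 mul0r mul1r !add0r.
apply: measurable_funD; apply: measurable_funM.
- exact: measurable_indic.
- exact: (ih (fun u => phi (v + u))).
- by apply: measurable_funB; [exact: measurable_cst|exact: measurable_indic].
- exact: ih.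
Qed.

Definition simple_restrict E s := [seq (E `&` Ev.1, Ev.2) | Ev <- s].

Lemma fine_measureDI E G : measurable E -> measurable G -> (mu E < +oo)%E ->
  fine (mu E) = fine (mu (E `&` G)) + fine (mu (E `\` G)).
Proof.
move=> mE mG muE.
have fin A : measurable A -> A `<=` E -> mu A \is a fin_num.
  move=> mA AE; rewrite ge0_fin_numE// (le_lt_trans _ muE)//.
  by apply: le_measure; rewrite ?inE.
rewrite (measureDI mu mE mG) addeC fineD//.
  by apply: fin => //; exact: measurableI.
by apply: fin => //; exact: measurableD.
Qed.

Lemma simple_int_restrictDI E G s : simple_on mu D s -> measurable E ->
  measurable G -> simple_int mu (simple_restrict E s) =
  simple_int mu (simple_restrict (E `&` G) s) +
  simple_int mu (simple_restrict (E `\` G) s).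
Proof.
move=> ss mE mG; rewrite /simple_int !big_map -big_split/=.
apply: eq_big_seq => Ev /ss[mEv _ muEv].
have mEEv := measurableI _ _ mE mEv.
have muEEv : (mu (E `&` Ev.1) < +oo)%E.
  by rewrite (le_lt_trans _ muEv)// le_measure ?inE.
rewrite -scalerDl -rmorphD (fine_measureDI mEEv mG muEEv).
by rewrite setIAC setIDAC setIDA.
Qed.

(* Generalized over [E] and [w] so that the induction can split [E] along the
   first set of [s] and add the corresponding value to [w]. *)
Lemma rnorm_simple_int_restrict_le E w s : simple_on mu D s ->
  measurable E -> (mu E < +oo)%E ->
  ((rnorm ((fine (mu E))%:C *: w + simple_int mu (simple_restrict E s)))%:E <=
   \int[mu]_(t in E) (rnorm (w + simple_val s t))%:E)%E.
Proof.
move=> + mE; elim: s E w mE => [|[G v] s ih] E w mE ss muE.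
  rewrite /simple_int /simple_val big_nil addr0 rnormZr ger0_norm ?fine_ge0//.
  under eq_integral do rewrite big_nil addr0.
  by rewrite integral_cst// EFinM fineK ?ge0_fin_numE// muleC.
have [[mG _ _] ss'] := simple_on_cons ss.
have [mEI mED] := (measurableI _ _ mE mG, measurableD mE mG).
have muS A : measurable A -> A `<=` E -> (mu A < +oo)%E.
  by move=> mA AE; rewrite (le_lt_trans _ muE)// le_measure ?inE.
have /leeD/(_ (ih _ w mED ss' (muS _ mED (@subDsetl _ _ _)))) :=
  ih _ (w + v) mEI ss' (muS _ mEI (@subIsetl _ _ _)).
rewrite -EFinD => /(le_trans _)/le_trans; apply.
  rewrite lee_fin; apply: le_trans (ler_rnormD _ _).
  rewrite le_eqVlt; apply/orP; left; apply/eqP; congr rnorm.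
  rewrite simple_int_cons/= (simple_int_restrictDI ss' mE mG).
  rewrite (fine_measureDI mE mG muE) rmorphD/= scalerDl [in RHS]scalerDr -!addrA.
  by congr (_ + _); rewrite [LHS]addrCA; congr (_ + _); exact: addrCA.
have mf : measurable_fun (E `&` G `|` E `\` G)
    (fun t => (rnorm (w + simple_val ((G, v) :: s) t))%:E).
  apply/measurable_EFinP/measurable_funTS.
  exact: (measurable_simple_val (fun u => rnorm (w + u))).
rewrite -[in leRHS](setUIDK E G) ge0_integral_setU//; last 2 first.
- by move=> t _; rewrite lee_fin rnorm_ge0.
- by apply/disj_setPS => t [[_ Gt] [_ /(_ Gt)]].
rewrite le_eqVlt; apply/orP; left; apply/eqP; congr (_ + _)%E;
  apply: eq_integral => t /[!inE] -[_ Gt]; rewrite simple_val_cons indicE.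
  by rewrite mem_set// scale1r addrA.
by rewrite memNset// scale0r add0r.
Qed.

Lemma rnorm_simple_int_le s : (mu D < +oo)%E -> simple_on mu D s ->
  ((rnorm (simple_int mu s))%:E <= \int[mu]_(t in D) (rnorm (simple_val s t))%:E)%E.
Proof.
move=> muD ss; have := rnorm_simple_int_restrict_le 0 ss mD muD.
rewrite scaler0 add0r; under eq_integral do rewrite add0r.
suff -> : simple_restrict D s = s by [].
rewrite /simple_restrict -[RHS]map_id; apply/eq_in_map => -[E v] /ss[_ ED _].
by rewrite setIidr.
Qed.

End simple_functions.

Section bochner_theory.
Context {d} {T : measurableType d} {R : realType} {V : normedModType R[i]}.
Variables (mu : {measure set T -> \bar R}) (D : set T).
Implicit Types (F : T -> V) (v : V).

Lemma is_bochnerN F v : is_bochner mu D F v -> is_bochner mu D (\- F) (- v).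
Proof.
move=> [s [ss aes sF sv]]; exists (fun n => simple_opp (s n)); split.
- by move=> n; exact: simple_on_opp.
- apply: filterS aes => t sFt Dt; under eq_fun do rewrite simple_val_opp.
  by apply: cvgN; exact: sFt.
- under eq_fun do under eq_integral do rewrite simple_val_opp -opprD normrN.
  exact: sF.
- by under eq_fun do rewrite simple_int_opp; exact: cvgN.
Qed.

Lemma bochnerP F : (exists v, is_bochner mu D F v) ->
  is_bochner mu D F (bochner mu D F).
Proof. exact: xgetPex. Qed.

End bochner_theory.

Section bochner_functional.
Context {d} {T : measurableType d} {R : realType} {V : normedModType R[i]}.
Variables (mu : {measure set T -> \bar R}) (D : set T) (mD : measurable D).
Variable (psi : V -> R).
Hypothesis psiD : forall u v, psi (u + v) = psi u + psi v.
Hypothesis psiZ : forall (c : R) v, psi (c%:C *: v) = c * psi v.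

Let psi0 : psi 0 = 0.
Proof. by rewrite -(scale0r 0) (psiZ 0) mul0r. Qed.

Let psiB u v : psi (u - v) = psi u - psi v.
Proof. by rewrite psiD -scaleN1r -(rmorphN1 (real_complex R)) psiZ mulN1r. Qed.

Lemma simple_int_functional s : simple_on mu D s ->
  mu.-integrable D (EFin \o (fun t => psi (simple_val s t))) /\
  (\int[mu]_(t in D) psi (simple_val s t) = psi (simple_int mu s))%R.
Proof.
elim: s => [|[E v] s ih] ss.
  rewrite /simple_int big_nil psi0; split.
    under [X in _.-integrable _ (_ \o X)]eq_fun do rewrite /simple_val big_nil psi0.
    exact: integrable0.
  by under eq_Rintegral do rewrite /simple_val big_nil psi0;
    rewrite Rintegral_cst// mul0r.
have [[mE ED muE] /ih[is_ ints]] := simple_on_cons ss.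
have iE : mu.-integrable D (EFin \o \1_E).
  apply/integrableP; split; first exact/measurable_EFinP/measurable_indic.
  rewrite (eq_integral (fun x => (\1_E x)%:E)); last first.
    by move=> t _; rewrite gee0_abs// lee_fin.
  by rewrite integral_indic// setIidl.
have iEv : mu.-integrable D (EFin \o (fun t => psi v * \1_E t)).
  exact: (integrableZl mD (psi v) iE).
have valE : (fun t => psi (simple_val ((E, v) :: s) t)) =
    (fun t => psi v * \1_E t + psi (simple_val s t)).
  by apply/funext => t; rewrite simple_val_cons psiD psiZ mulrC.
rewrite valE; split; first exact: (integrableD mD iEv is_).
rewrite RintegralD// RintegralZl// ints simple_int_cons psiD psiZ mulrC.
by rewrite /Rintegral integral_indic// setIidl.
Qed.

Lemma bochner_functional F v k : 0 < k -> (forall u, `|psi u| <= k * rnorm u) ->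
  mu.-integrable D (EFin \o (fun t => psi (F t))) -> is_bochner mu D F v ->
  psi v = \int[mu]_(t in D) psi (F t).
Proof.
move=> k0 psik iF [s [ss _ sF sv]]; set I := Rintegral mu D _.
have [sF_fin sF0] := (fine_cvgP _ _).1 sF.
pose e n := fine (\int[mu]_(t in D) (rnorm (F t - simple_val (s n) t))%:E)%E.
have psi_dist n :
    (\int[mu]_(t in D) (rnorm (F t - simple_val (s n) t))%:E)%E \is a fin_num ->
    `|psi (simple_int mu (s n)) - I| <= k * e n.
  move=> sFn; have [is_ <-] := simple_int_functional (ss n).
  have iB := integrable_abse (integrableB mD iF is_).
  have iBk := integrableZl mD k^-1 iB.
  rewrite distrC -RintegralB// (le_trans (le_normr_Rintegral mD _))//.
    exact: (integrableB mD iF is_).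
  rewrite -ler_pdivrMl// -RintegralZl// /Rintegral fine_le//.
    exact: (integrable_fin_num mD iBk).
  apply: ge0_le_integral_nonmeasurable => t _.
    by rewrite lee_fin mulr_ge0// invr_ge0 ltW.
  by rewrite lee_fin ler_pdivrMl// -psiB.
have dist0 : k * (rnorm (v - simple_int mu (s n)) + e n) @[n --> \oo] --> 0.
  rewrite -(mulr0 k) -[X in k * X]addr0; apply: cvgM; first exact: cvg_cst.
  by apply: cvgD => //; exact/cvg_rnormP.
apply/eqP; rewrite -subr_eq0 -normr_le0; apply: (cvgr_to_ge dist0).
apply: filterS sF_fin => n sFn; rewrite mulrDr.
apply: le_trans (ler_distD (psi (simple_int mu (s n))) _ _) _.
by rewrite -psiB lerD// psi_dist.
Qed.

End bochner_functional.

Section bounded_convergence.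
Context {d} {T : measurableType d} {R : realType} {V : completeNormedModType R[i]}.
Variables (mu : {measure set T -> \bar R}) (D : set T) (mD : measurable D).
Hypothesis muD : (mu D < +oo)%E.
Variables (s : nat -> seq (set T * V)) (F : T -> V) (k : R).
Hypothesis ss : forall n, simple_on mu D (s n).
Hypothesis sk : forall n t, D t -> rnorm (simple_val (s n) t) <= k.
Hypothesis sF : forall t, D t -> simple_val (s n) t @[n --> \oo] --> F t.

Let dist n t := rnorm (F t - simple_val (s n) t).

Let dist_le n t : D t -> `|dist n t| <= k + k.
Proof.
move=> Dt; rewrite ger0_norm ?rnorm_ge0// (le_trans (ler_rnormB _ _))// lerD//.
  by apply: (cvg_rnorm_le (sF Dt)); apply: nearW => m; exact: sk.
exact: sk.
Qed.

Let measurable_dist n : measurable_fun D (dist n).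
Proof.
apply: (@measurable_fun_cvg _ _ _ _
  (fun m t => rnorm (simple_val (s m) t - simple_val (s n) t))) => [m|t Dt].
  under eq_fun do rewrite -simple_val_sub.
  apply: measurable_funTS; apply: (measurable_simple_val (mu := mu) (D := D)).
  exact: simple_on_sub (@ss m) (@ss n).
by apply: cvg_rnorm; apply: cvgB; [exact: sF|exact: cvg_cst].
Qed.

Let integrable_dist n : mu.-integrable D (EFin \o dist n).
Proof. exact: (bounded_integrable mD muD (@measurable_dist n) (@dist_le n)). Qed.

Let integral_dist_cvg0 : (\int[mu]_(t in D) (dist n t)%:E)%E @[n --> \oo] --> 0%E.
Proof.
rewrite -(@integral0 _ _ _ mu D).
apply: (@dominated_cvg _ _ _ mu D mD (fun n t => (dist n t)%:E) (cst 0%E)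
  (EFin \o cst (k + k))) => // [n|t Dt|].
- exact/measurable_EFinP.
- by apply: cvg_EFin; [exact: nearW|exact/cvg_rnormP/sF].
- by apply: (bounded_integrable (k := `|k + k|)) => //; exact: measurable_cst.
Qed.

Let simple_int_dist n m : rnorm (simple_int mu (s n) - simple_int mu (s m)) <=
  (\int[mu]_(t in D) dist n t + \int[mu]_(t in D) dist m t)%R.
Proof.
rewrite -lee_fin -RintegralD//.
have iD : mu.-integrable D (EFin \o (fun t => dist n t + dist m t)).
  exact: (integrableD mD (integrable_dist n) (integrable_dist m)).
rewrite fineK ?(integrable_fin_num mD iD)// -simple_int_sub.
apply: le_trans (rnorm_simple_int_le mD muD (simple_on_sub (@ss n) (@ss m))) _.
apply: ge0_le_integral_nonmeasurable => t _; rewrite lee_fin ?rnorm_ge0//.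
rewrite simple_val_sub (le_trans (ler_rnorm_distD (F t) _ _))//.
by rewrite rnorm_distC.
Qed.

Lemma bounded_cvg_is_bochner : exists v, is_bochner mu D F v.
Proof.
have [_ e0] := (fine_cvgP _ _).1 integral_dist_cvg0.
have [v sv] := rnorm_cauchy_cvg e0 simple_int_dist.
by exists v, s; split=> //; apply: aeW.
Qed.

End bounded_convergence.

Section step_functions.
Context {R : realType} {V : completeNormedModType R[i]}.
Local Notation D := (`[0, 1]%classic : set (measurableTypeR R)).
Variables (mu : {measure set (measurableTypeR R) -> \bar R}) (F : R -> V).

Let mD : measurable D. Proof. exact: measurable_itv. Qed.

Definition grid_floor n (t : R) : R := (Num.truncn (t * n.+1%:R))%:R / n.+1%:R.

Lemma grid_floor_itv01 n t : 0 <= t <= 1 -> 0 <= grid_floor n t <= 1.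
Proof.
move=> /andP[t0 t1]; have n0 : 0 < n.+1%:R :> R by rewrite ltr0n.
rewrite divr_ge0//= ler_pdivrMr// mul1r.
by rewrite (le_trans _ (ler_piMl (ltW n0) t1))// truncn_le mulr_ge0.
Qed.

Lemma grid_floor0 n : grid_floor n 0 = 0.
Proof. by rewrite /grid_floor mul0r truncn0 mul0r. Qed.

Lemma grid_floor1 n : grid_floor n 1 = 1.
Proof. by rewrite /grid_floor mul1r natrK divff ?gt_eqF ?ltr0n. Qed.

Lemma cvg_grid_floor t : 0 <= t -> grid_floor n t @[n --> \oo] --> t.
Proof.
move=> t0; apply: (@squeeze_cvgr _ _ _ _ (fun n => t - n.+1%:R^-1) (cst t)).
- apply: nearW => n; have n0 : 0 < n.+1%:R :> R by rewrite ltr0n.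
  have /andP[k_le lt_k] := truncn_itv (mulr_ge0 t0 (ltW n0)).
  rewrite /grid_floor lerBlDr -[X in _ + X]mul1r -mulrDl natr1.
  by rewrite ler_pdivlMr// ler_pdivrMr// k_le ltW.
- by rewrite -[X in _ --> X]subr0; apply: cvgB; [exact: cvg_cst|exact: cvg_harmonic].
- exact: cvg_cst.
Qed.

Definition grid_cell n k : set (measurableTypeR R) :=
  `[k%:R / n.+1%:R, k.+1%:R / n.+1%:R[%classic `&` D.

Definition grid_step n :=
  [seq (grid_cell n k, F (k%:R / n.+1%:R)) | k <- iota 0 n.+2].

Lemma grid_step_valE n t : D t -> simple_val (grid_step n) t = F (grid_floor n t).
Proof.
rewrite /= in_itv/= => t01; have /andP[t0 t1] := t01.
have n0 : 0 < n.+1%:R :> R by rewrite ltr0n.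
pose k := Num.truncn (t * n.+1%:R).
have kn : (k <= n.+1)%N.
  have /andP[_] := grid_floor_itv01 n t01.
  by rewrite /grid_floor ler_pdivrMr// mul1r ler_nat.
rewrite /simple_val big_map (bigD1_seq k) ?iota_uniq ?mem_iota//=.
rewrite indicE mem_set; last first.
  split; rewrite /= in_itv/= ?t01// ler_pdivrMr// ltr_pdivlMr//.
  by apply: truncn_itv; rewrite mulr_ge0.
rewrite scale1r big1 ?addr0// => j jk.
rewrite indicE memNset ?scale0r// => -[/=].
rewrite in_itv/= ler_pdivrMr// ltr_pdivlMr// => /truncn_def jE _.
by move: jk; rewrite /k jE eqxx.
Qed.

Lemma grid_step_simple n : (mu D < +oo)%E -> simple_on mu D (grid_step n).
Proof.
move=> muD _ /mapP[k _ ->] /=.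
have mc : measurable (grid_cell n k).
  by apply: measurableI => //; exact: measurable_itv.
split=> //; first exact: subIsetr.
by rewrite (le_lt_trans _ muD)// le_measure ?inE//; exact: subIsetr.
Qed.

Lemma bounded_continuous_is_bochner k : (mu D < +oo)%E ->
  {in `[0, 1], forall t, rnorm (F t) <= k} ->
  {in `]0, 1[, continuous F} ->
  exists v, is_bochner mu D F v.
Proof.
move=> muD Fk Fcont.
apply: (@bounded_cvg_is_bochner _ _ _ _ mu D mD muD grid_step F k).
- by move=> n; exact: grid_step_simple.
- move=> n t; rewrite /= in_itv/= => t01; rewrite grid_step_valE ?/= ?in_itv//.
  by apply: Fk; rewrite in_itv/= grid_floor_itv01.
move=> t; rewrite /= in_itv/= => t01; have /andP[t0 t1] := t01.
have Dt : D t by rewrite /= in_itv.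
under eq_fun do rewrite grid_step_valE//.
have [->|t_neq0] := eqVneq t 0.
  by under eq_fun do rewrite grid_floor0; exact: cvg_cst.
have [->|t_neq1] := eqVneq t 1.
  by under eq_fun do rewrite grid_floor1; exact: cvg_cst.
have t01' : t \in `]0, 1[ by rewrite in_itv/= !lt_neqAle eq_sym t_neq0 t0 t_neq1.
exact: cvg_comp (cvg_grid_floor t0) (Fcont t t01').
Qed.

End step_functions.

(** * The measures eta and sigma *)

Lemma bigcup_itvcc_oc {R : realType} (a b : R) : a < b ->
  \bigcup_n `[a + (b - a) / n.+2%:R, b]%classic = `]a, b]%classic.
Proof.
move=> ab; have ba0 : 0 < b - a by rewrite subr_gt0.
apply/seteqP; split=> [x [n _]|x]; rewrite /= !in_itv/= => /andP[ax xb].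
  by rewrite xb (lt_le_trans _ ax)// ltrDl divr_gt0// ltr0n.
exists (Num.truncn ((b - a) / (x - a))) => //=; rewrite in_itv/= xb andbT.
rewrite -lerBrDl ler_pdivrMr ?ltr0n// mulrC -ler_pdivrMr ?subr_gt0//.
by rewrite (le_trans (ltW (truncnS_gt _)))// ler_nat.
Qed.

Lemma ge0_continuous_FTC2_oc {R : realType} (f F : R -> R) (a b l : R) :
  a < b -> {in `]a, b], forall x, 0 <= f x} -> {in `]a, b], continuous f} ->
  {in `]a, b], forall x : R, is_derive x (1 : R) F (f x)} ->
  F x @[x --> a^'+] --> l ->
  (\int[lebesgue_measure]_(x in `]a, b]) (f x)%:E = (F b - l)%:E)%E.
Proof.
move=> ab f0 fc F'f Fl; have ba0 : 0 < b - a by rewrite subr_gt0.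
pose e n := a + (b - a) / n.+2%:R.
have ae n : a < e n by rewrite ltrDl divr_gt0// ltr0n.
have eb n : e n < b.
  by rewrite /e -ltrBrDl ltr_pdivrMr ?ltr0n// ltr_pMr// ltr1n.
have sub n x : x \in `[e n, b] -> x \in `]a, b].
  by rewrite !in_itv/= => /andP[/(lt_le_trans (ae n)) -> ->].
have fc_within n : {within `[e n, b], continuous f}.
  by apply: continuous_in_subspaceT => x /[!inE] /sub/fc.
have Fc x : x \in `]a, b] -> {for x, continuous F}.
  by move=> /F'f F'x; apply/differentiable_continuous/derivable1_diffP.
have FTC n : (\int[lebesgue_measure]_(x in `[e n, b]) (f x)%:E =
    (F b - F (e n))%:E)%E.
  have [een bbn] : e n \in `[e n, b] /\ b \in `[e n, b].
    by rewrite !in_itv/= !lexx ltW.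
  rewrite (@continuous_FTC2 _ f F)//.
  - split=> [x xen||].
    + by have [] := F'f x (sub n x (subset_itv_oo_cc xen)).
    + by apply/cvg_at_right_filter/Fc/sub/een.
    + by apply/cvg_at_left_filter/Fc/sub/bbn.
  - move=> x xen; rewrite derive1E.
    by have /@derive_val := F'f x (sub n x (subset_itv_oo_cc xen)).
have lim_F : (F b - F (e n))%:E @[n --> \oo] --> (F b - l)%:E.
  apply: cvg_EFin; first exact: nearW.
  apply: cvgB; first exact: cvg_cst.
  apply: ((cvg_at_rightP _ _ _).1 Fl); split=> //.
  rewrite -[X in _ --> X]addr0 -(mulr0 (b - a)); apply: cvgD; first exact: cvg_cst.
  apply: cvgM; first exact: cvg_cst.
  by have := @cvg_harmonic R; rewrite -cvg_shiftS.
rewrite -(funext FTC) in lim_F; apply: (cvg_unique _ _ lim_F) => //.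
rewrite -bigcup_itvcc_oc//; apply: ge0_nondecreasing_set_cvg_integral => // [|n|n x].
- move=> n m nm; rewrite subsetEset => x; rewrite /= !in_itv/= => /andP[ex ->].
  rewrite andbT (le_trans _ ex)// lerD2l ler_pM2l// lef_pV2 ?posrE ?ltr0n//.
  by rewrite ler_nat.
- apply/measurable_EFinP; apply: subspace_continuous_measurable_fun => //.
- by move=> xen; rewrite lee_fin; apply/f0/(sub n).
Qed.

Section density.
Context {d} {T : measurableType d} {R : realType}.
Variables (nu : {finite_measure set T -> \bar R}).
Variables (mu : {sigma_finite_measure set T -> \bar R}).
Variables (D : set T) (g : T -> R).
Hypotheses (mD : measurable D) (mg : measurable_fun D g).
Hypothesis nuE : forall A, measurable A ->
  nu A = (\int[mu]_(x in A `&` D) (g x)%:E)%E.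

Lemma density_dominates : nu `<< mu.
Proof.
apply/null_content_dominatesP => A mA muA0; rewrite nuE//.
have mAD := measurableI _ _ mA mD.
apply: null_set_integral => //.
  by apply/measurable_EFinP; apply: measurable_funS mg => //; exact: subIsetr.
by apply/eqP; rewrite -measure_le0 -muA0 le_measure ?inE//; exact: subIsetl.
Qed.

Lemma integral_density (f : T -> \bar R) : nu.-integrable D f ->
  (\int[nu]_(x in D) f x = \int[mu]_(x in D) (f x * (g x)%:E))%E.
Proof.
move=> intf; rewrite -(Radon_Nikodym_change_of_variables density_dominates)//.
have mf := measurable_int nu intf.
have intRN : mu.-integrable D (Radon_Nikodym (charge_of_finite_measure nu) mu).
  apply: (integrableS measurableT) => //; apply: Radon_Nikodym_integrable.
  exact: density_dominates.
apply: ae_eq_integral => //.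
- exact: emeasurable_funM (measurable_int mu intRN).
- by apply: emeasurable_funM => //; exact/measurable_EFinP.
- apply: ae_eqe_mul2l; apply: integral_ae_eq => // [|A AD mA].
    exact/measurable_EFinP.
  rewrite -Radon_Nikodym_integral//=; last exact: density_dominates.
  by have := nuE mA; rewrite (setIidl AD).
Qed.

End density.

Section Rintegral_measure.
Context {d} {T : measurableType d} {R : realType}.
Variables (D : set T) (mD : measurable D) (f : T -> R).
Implicit Types (mu nu : {measure set T -> \bar R}) (k : {nonneg R}).

Lemma integrable_mscale mu k : mu.-integrable D (EFin \o f) ->
  (mscale k mu).-integrable D (EFin \o f).
Proof.
move=> /integrableP[mf f_lty]; apply/integrableP; split=> //.
rewrite ge0_integral_mscale//; last exact: measurableT_comp.
by rewrite lte_mul_pinfty// lee_fin.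
Qed.

Lemma Rintegral_mscale mu k : mu.-integrable D (EFin \o f) ->
  (\int[mscale k mu]_(t in D) f t = k%:num * \int[mu]_(t in D) f t)%R.
Proof.
move=> intf; have mf := measurable_int mu intf.
rewrite -[k%:num]/(fine k%:num%:E) -fineM//; last exact: integrable_fin_num.
congr fine; rewrite [LHS]integralE [X in (_ * X)%E]integralE muleBr//; last first.
  exact: integrable_add_def.
rewrite !ge0_integral_mscale//; first exact: measurable_funeneg.
exact: measurable_funepos.
Qed.

Lemma Rintegral_measure_add mu nu :
  mu.-integrable D (EFin \o f) -> nu.-integrable D (EFin \o f) ->
  (\int[measure_add mu nu]_(t in D) f t =
   \int[mu]_(t in D) f t + \int[nu]_(t in D) f t)%R.
Proof.
move=> intmu intnu; rewrite /Rintegral integral_measure_add// fineD//;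
  exact: integrable_fin_num.
Qed.

End Rintegral_measure.

Lemma mscale_lty {d} {T : measurableType d} {R : realType}
    (mu : {measure set T -> \bar R}) (D : set T) (k : {nonneg R}) :
  (mu D < +oo)%E -> (mscale k mu D < +oo)%E.
Proof. by move=> muD; rewrite /mscale/= lte_mul_pinfty// lee_fin. Qed.

Section jensen.
Context {R : realType}.
Variables (mu : {measure set (measurableTypeR R) -> \bar R}).
Variables (D : set (measurableTypeR R)) (mD : measurable D).
Hypothesis muD1 : mu D = 1%E.
Hypothesis intid : mu.-integrable D (EFin \o (fun t : R => t)).
Implicit Types (c k : R) (g : R -> R).

Local Notation m := (\int[mu]_(t in D) (t : R))%R.

Let integrable_cst c : mu.-integrable D (EFin \o cst c).
Proof.
by apply: (bounded_integrable (k := `|c|)) => //; rewrite muD1 ltry.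
Qed.

Lemma integrable_affine c k : mu.-integrable D (EFin \o (fun t : R => c + k * t)).
Proof. exact: (integrableD mD (integrable_cst c) (integrableZl mD k intid)). Qed.

Lemma Rintegral_affine c k : (\int[mu]_(t in D) (c + k * t) = c + k * m)%R.
Proof.
rewrite RintegralD//; last 2 first.
- exact: integrable_cst.
- exact: (integrableZl mD k intid).
by rewrite RintegralZl// Rintegral_cst// muD1/= mulr1.
Qed.

Variable g : R -> R.
Hypothesis intg : mu.-integrable D (EFin \o g).
Hypothesis convexg : convex_function (D : set R^o) (g : R^o -> R^o).

Lemma convex_function_jensen a b : D a -> D b -> a < m < b ->
  g m <= (\int[mu]_(t in D) g t)%R.
Proof.
move=> Da Db /(convex_function_support convexg Da Db)[k gk].
have -> : g m = (\int[mu]_(t in D) ((g m - k * m) + k * t))%R.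
  by rewrite Rintegral_affine subrK.
apply: le_Rintegral => // [|t /gk]; first exact: integrable_affine.
by rewrite mulrBr; lra.
Qed.

Lemma convex_function_le_chord a b : D `<=` `[a, b]%classic -> D a -> D b ->
  (b - a) * (\int[mu]_(t in D) g t)%R <= (b - m) * g a + (m - a) * g b.
Proof.
move=> Dab Da Db.
have -> : (b - m) * g a + (m - a) * g b =
    (\int[mu]_(t in D) ((b * g a - a * g b) + (g b - g a) * t))%R.
  by rewrite Rintegral_affine; ring.
rewrite -RintegralZl//; apply: le_Rintegral => // [||t Dt].
- exact: (integrableZl mD _ intg).
- exact: integrable_affine.
have /= := Dab t Dt; rewrite in_itv/= => atb.
by have := convex_function_barycentre convexg Da Db atb; lra.
Qed.

End jensen.

Section eta_theory.
Context {R : realType}.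
Local Notation D := (`[0, 1]%classic : set (measurableTypeR R)).
Implicit Types (l b : R).

Let mD : measurable D. Proof. exact: measurable_itv. Qed.

Let D0 : D 0. Proof. by rewrite /= in_itv/= lexx ler01. Qed.

Let D1 : D 1. Proof. by rewrite /= in_itv/= lexx ler01. Qed.

Lemma integral_powR01 (c : R) : 0 < c ->
  (\int[lebesgue_measure]_(t in D) (c * t `^ (c - 1))%:E = 1)%E.
Proof.
move=> c0; rewrite -integral_itv_obnd_cbnd; last first.
  by apply/measurable_EFinP/measurable_funTS; exact: measurable_funM.
rewrite (@ge0_continuous_FTC2_oc _ _ (@powR R ^~ c) _ _ 0)//.
- by rewrite powR1 subr0.
- by move=> t _; rewrite mulr_ge0 ?powR_ge0// ltW.
- move=> t; rewrite in_itv/= => /andP[t0 _].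
  have powR_cont : {for t, continuous (@powR R ^~ (c - 1))}.
    apply/differentiable_continuous/derivable1_diffP.
    by apply: derivable_powR; rewrite in_itv/= t0.
  by apply: cvgM; [exact: cvg_cst|exact: powR_cont].
- by move=> t; rewrite in_itv/= => /andP[t0 _]; exact: is_derive1_powR.
- exact: powR_cvg0.
Qed.

Lemma eta_pdfE l t : l != 1 ->
  eta_pdf l t = l / (1 - l) * t `^ (l / (1 - l) - 1).
Proof.
move=> l1; congr (_ * _ `^ _); field.
by rewrite subr_eq0 eq_sym.
Qed.

Lemma eta0E E : eta 0 E = \d_(0 : measurableTypeR R) E.
Proof. by rewrite /eta lexx. Qed.

Lemma eta1E E : eta 1 E = \d_(1 : measurableTypeR R) E.
Proof. by rewrite /eta ler10 lexx. Qed.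

Lemma eta_interior l E : 0 < l < 1 ->
  (eta l E = \int[lebesgue_measure]_(t in E `&` D) (eta_pdf l t)%:E)%E.
Proof. by move=> /andP[l0 l1]; rewrite /eta leNgt l0/= leNgt l1. Qed.

Lemma eta_itv01 l : eta l D = 1%E.
Proof.
have [l0|l0] := leP l 0; first by rewrite /eta l0 diracE (mem_set D0).
have [l1|l1] := leP 1 l; first by rewrite /eta leNgt l0/= l1 diracE (mem_set D1).
rewrite eta_interior ?l0// setIid.
under eq_integral do rewrite eta_pdfE ?lt_eqF//.
by rewrite integral_powR01// divr_gt0// subr_gt0.
Qed.

Lemma eta_itv01_lty l : (eta l D < +oo)%E.
Proof. by rewrite eta_itv01 ltry. Qed.

Lemma eta_setT l : eta l setT = 1%E.
Proof.
have [l0|l0] := leP l 0; first by rewrite /eta l0 diracT.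
have [l1|l1] := leP 1 l; first by rewrite /eta leNgt l0/= l1 diracT.
rewrite eta_interior ?l0// setTI -[X in integral _ X]setIid -eta_interior ?l0//.
exact: eta_itv01.
Qed.

HB.instance Definition _ l :=
  Measure_isProbability.Build _ _ _ (eta l) (eta_setT l).

Lemma integral_eta l (f : R -> \bar R) : 0 < l < 1 -> (eta l).-integrable D f ->
  (\int[eta l]_(t in D) f t =
   \int[lebesgue_measure]_(t in D) (f t * (eta_pdf l t)%:E))%E.
Proof.
move=> l01; have /andP[l0 l1] := l01.
apply: integral_density => // [|A _]; last exact: eta_interior.
by apply: measurable_funTS; exact: measurable_eta_pdf.
Qed.

Lemma Rintegral_eta0 g : measurable_fun D g -> (\int[eta 0]_(t in D) g t)%R = g 0.
Proof.
move=> mg; rewrite /Rintegral (eq_measure_integral (\d_(0 : measurableTypeR R))).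
  by rewrite integral_dirac ?diracE ?(mem_set D0) ?mul1e//; exact/measurable_EFinP.
by move=> A _ _; exact: eta0E.
Qed.

Lemma Rintegral_eta1 g : measurable_fun D g -> (\int[eta 1]_(t in D) g t)%R = g 1.
Proof.
move=> mg; rewrite /Rintegral (eq_measure_integral (\d_(1 : measurableTypeR R))).
  by rewrite integral_dirac ?diracE ?(mem_set D1) ?mul1e//; exact/measurable_EFinP.
by move=> A _ _; exact: eta1E.
Qed.

Lemma integrable_id_eta l : (eta l).-integrable D (EFin \o (fun t : R => t)).
Proof.
apply: (bounded_integrable (k := 1)) => // [|t]; first exact: eta_itv01_lty.
by rewrite /= in_itv/= => /andP[t0 t1]; rewrite ger0_norm.
Qed.

Lemma eta_mean l : 0 <= l <= 1 -> (\int[eta l]_(t in D) (t : R))%R = l.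
Proof.
move=> /andP[]; rewrite !le_eqVlt => /predU1P[<- _|l0 /predU1P[->|l1]].
- by rewrite Rintegral_eta0.
- by rewrite Rintegral_eta1.
have l01 : 0 < l < 1 by rewrite l0.
pose c := l / (1 - l).
have c0 : 0 < c + 1 by rewrite addr_gt0// divr_gt0// subr_gt0.
rewrite /Rintegral integral_eta//; last exact: integrable_id_eta.
have cE t : D t -> (t%:E * (eta_pdf l t)%:E =
    l%:E * ((c + 1) * t `^ (c + 1 - 1))%:E)%E.
  rewrite /= in_itv/= => /andP[t0 _]; rewrite -!EFinM addrK eta_pdfE ?lt_eqF//.
  rewrite mulrCA mulr_powRB1 ?divr_gt0 ?subr_gt0// mulrA; congr (_ * _)%:E.
  by rewrite /c; field; rewrite subr_eq0 gt_eqF.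
under eq_integral => t /[!inE] Dt do rewrite cE//.
rewrite ge0_integralZl//=.
- by rewrite integral_powR01// mule1.
- by apply/measurable_EFinP/measurable_funTS; exact: measurable_funM.
- by move=> t _; rewrite lee_fin mulr_ge0 ?powR_ge0// ltW.
- by rewrite lee_fin ltW.
Qed.

Lemma sigma_itv01_lty (l : R) (a : {i01 R}) : (sigma l a D < +oo)%E.
Proof.
rewrite [X in (X < _)%E](measure_addE (mscale (1 - a%:num)%:nng (eta l))
  (mscale a%:num%:nng (eta (1 - l))) D).
by rewrite lte_add_pinfty//; apply: mscale_lty; exact: eta_itv01_lty.
Qed.

Section convex_integrand.
Variable g : R -> R.
Hypothesis convexg : convex_function (`[0, 1]%classic : set R^o) (g : R^o -> R^o).

Let mg : measurable_fun D g.
Proof. by apply: convex_function_measurable convexg; exact: interval_is_interval. Qed.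

Let gk t : D t -> `|g t| <= 2 * `|g ((0 + 1) / 2)| + `|g 0| + `|g 1|.
Proof. by rewrite /= in_itv/=; exact: (convex_function_bounded ltr01 convexg). Qed.

Lemma convex_function_integrable
    (mu : {measure set (measurableTypeR R) -> \bar R}) :
  (mu D < +oo)%E -> mu.-integrable D (EFin \o g).
Proof. by move=> muD; exact: (bounded_integrable mD muD mg gk). Qed.

Lemma eta_jensen b : 0 <= b <= 1 -> g b <= (\int[eta b]_(t in D) g t)%R.
Proof.
move=> b01; have /andP[b0 b1] := b01.
have [->|b_neq0] := eqVneq b 0; first by rewrite (Rintegral_eta0 mg).
have [->|b_neq1] := eqVneq b 1; first by rewrite (Rintegral_eta1 mg).
rewrite -[in g b](eta_mean b01); apply: (convex_function_jensen mD (eta_itv01 b)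
  (integrable_id_eta b) _ convexg D0 D1).
  exact: convex_function_integrable (eta_itv01_lty b).
by rewrite eta_mean// !lt_neqAle eq_sym b_neq0 b0 b_neq1.
Qed.

Lemma eta_le_chord b : 0 <= b <= 1 ->
  (\int[eta b]_(t in D) g t)%R <= (1 - b) * g 0 + b * g 1.
Proof.
move=> b01; have := convex_function_le_chord mD (eta_itv01 b)
  (integrable_id_eta b) (convex_function_integrable (eta_itv01_lty b)) convexg
  (@subset_refl _ D) D0 D1.
by rewrite eta_mean// !subr0 mul1r.
Qed.

Lemma Rintegral_sigma l (a : {i01 R}) : (\int[sigma l a]_(t in D) g t =
  (1 - a%:num) * \int[eta l]_(t in D) g t +
  a%:num * \int[eta (1 - l)]_(t in D) g t)%R.
Proof.
have int_eta b := convex_function_integrable (eta_itv01_lty b).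
have int_mscale b (k : {nonneg R}) := integrable_mscale mD k (int_eta b).
rewrite /sigma Rintegral_measure_add; [|exact: mD|exact: int_mscale..].
by congr (_ + _); exact: (Rintegral_mscale mD _ (int_eta _)).
Qed.

Lemma sigma_jensen l (a : {i01 R}) : 0 <= l <= 1 ->
  (1 - a%:num) * g l + a%:num * g (1 - l) <= (\int[sigma l a]_(t in D) g t)%R.
Proof.
move=> l01; have l01' : 0 <= 1 - l <= 1.
  by move: l01 => /andP[? ?]; apply/andP; split; lra.
by rewrite Rintegral_sigma lerD// ler_wpM2l ?subr_ge0// eta_jensen.
Qed.

Lemma sigma_le_chord l (a : {i01 R}) : 0 <= l <= 1 ->
  (\int[sigma l a]_(t in D) g t)%R <=
  (1 - r_weight l a%:num) * g 0 + r_weight l a%:num * g 1.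
Proof.
move=> l01; have l01' : 0 <= 1 - l <= 1.
  by move: l01 => /andP[? ?]; apply/andP; split; lra.
have a1 : 0 <= 1 - a%:num by rewrite subr_ge0.
have a0 : 0 <= a%:num by [].
rewrite Rintegral_sigma; apply: le_trans (lerD
  (ler_wpM2l a1 (eta_le_chord l01)) (ler_wpM2l a0 (eta_le_chord l01'))) _.
by rewrite /r_weight; lra.
Qed.

End convex_integrand.

End eta_theory.

(** * Operator-valued convex maps *)

Section bochner_operator.
Context {d} {T : measurableType d} {R : realType} {H : hilbertType R}.
Variables (mu : {measure set T -> \bar R}) (D : set T) (mD : measurable D).
Implicit Types (F : T -> 'B(H)) (v : 'B(H)).

Lemma bochner_self_adjoint F v : (forall t, D t -> self_adjoint (F t)) ->
  is_bochner mu D F v -> self_adjoint v.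
Proof.
move=> sF Fv; apply/self_adjointP => x y; apply/eqP; rewrite -subr_eq0; apply/eqP.
have F0 t : t \in D -> rdot (F t x) y - rdot x (F t y) = 0.
  by move=> /[!inE] /sF/self_adjointP ->; rewrite subrr.
rewrite (bochner_functional (psi := fun S : 'B(H) => rdot (S x) y - rdot x (S y))
  mD _ _ (k := rnorm x * rnorm y * 2 + 1) _ _ _ Fv).
- by rewrite (eq_Rintegral mu F0) Rintegral_cst ?mul0r.
- by move=> S S'; rewrite !bopDE rdotDl rdotDr; ring.
- by move=> c S; rewrite !bopZE rdotZl rdotZr; ring.
- by rewrite ltr_wpDl// !mulr_ge0// rnorm_ge0.
- move=> S; have Sle u : rnorm (S u) <= rnorm S * rnorm u := ler_rnorm_op S u.
  rewrite (le_trans (ler_normB _ _))//.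
  have := le_trans (ler_norm_rdot (S x) y) (ler_wpM2r (rnorm_ge0 y) (Sle x)).
  have := le_trans (ler_norm_rdot x (S y)) (ler_wpM2l (rnorm_ge0 x) (Sle y)).
  by have := rnorm_ge0 S; lra.
- apply: (eq_integrable mD (cst 0%E)) => [t Dt|]; first by rewrite /= F0.
  exact: integrable0.
Qed.

Lemma bochner_qform F v x : is_bochner mu D F v ->
  mu.-integrable D (EFin \o (fun t => qform (F t) x)) ->
  qform v x = (\int[mu]_(t in D) qform (F t) x)%R.
Proof.
move=> Fv iF; apply: (bochner_functional (psi := fun S : 'B(H) => qform S x)
  mD _ _ (k := rnorm x ^+ 2 + 1) _ _ iF Fv) => [S S'|c S||S].
- exact: qformD.
- exact: qformZ.
- by rewrite ltr_wpDl// sqr_ge0.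
- by rewrite (le_trans (ler_norm_qform _ _))// mulrC ler_wpM2r ?rnorm_ge0// lerDl.
Qed.

End bochner_operator.

Section op_convex.
Context {R : realType} {H : hilbertType R}.
Local Notation D := (`[0, 1]%classic : set (measurableTypeR R)).
Implicit Types (F : R -> 'B(H)) (v w : 'B(H)) (x : H).

Definition op_convex01 F := (forall t, 0 <= t <= 1 -> self_adjoint (F t)) /\
  forall s t l, 0 <= s <= 1 -> 0 <= t <= 1 -> 0 <= l <= 1 ->
    F ((1 - l) * s + l * t) <=op nabla l (F s) (F t).

Lemma op_convex01_qform F x : op_convex01 F ->
  convex_function (`[0, 1]%classic : set R^o) (fun t : R^o => qform (F t) x : R^o).
Proof.
move=> [sF cF]; apply/convex_functionP => s t l; rewrite /= !in_itv/= => s01 t01 l01.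
rewrite -qform_nabla; move: x; apply/op_leP; last exact: cF.
  apply: sF; have := @is_interval_convex R _ s t l (@interval_is_interval R `[0, 1]).
  by rewrite /= !in_itv/=; exact.
by apply: self_adjoint_nabla; exact: sF.
Qed.

Lemma op_convex01_bounded F t : op_convex01 F -> 0 <= t <= 1 ->
  rnorm (F t) <= 2 * rnorm (F ((0 + 1) / 2)) + rnorm (F 0) + rnorm (F 1).
Proof.
move=> cF t01; apply: self_adjoint_rnorm_le => [||x].
- exact: cF.1.
- by rewrite !addr_ge0 ?mulr_ge0 ?rnorm_ge0.
- rewrite (le_trans (convex_function_bounded ltr01 (op_convex01_qform x cF) t01))//.
  by rewrite !mulrDl -mulrA !lerD ?ler_norm_qform// ler_pM2l// ler_norm_qform.
Qed.

Lemma op_convex01_lipschitz F k d s t : op_convex01 F ->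
  (forall u, 0 <= u <= 1 -> rnorm (F u) <= k) ->
  0 < d -> d <= t -> d <= 1 - t -> `|t - s| <= d ->
  rnorm (F t - F s) <= 2 * k * (`|t - s| / d).
Proof.
move=> cF Fk d0 dt dt' tsd.
have [[t01 s01] [tBd01 tDd01]] :
    (0 <= t <= 1 /\ 0 <= s <= 1) /\ (0 <= t - d <= 1 /\ 0 <= t + d <= 1).
  have /andP[? ?] : t - d <= s <= t + d by rewrite -ler_distlC.
  by do !split; apply/andP; split; lra.
have k0 : 0 <= k := le_trans (rnorm_ge0 _) (Fk t t01).
have D01 u : 0 <= u <= 1 -> `[0, 1]%classic u by rewrite /= in_itv.
apply: self_adjoint_rnorm_le => [||x].
- by apply: self_adjointB; exact: cF.1.
- by rewrite !mulr_ge0// invr_ge0 ltW.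
have qformk u : `[0, 1]%classic u -> `|qform (F u) x| <= k * rnorm x ^+ 2.
  rewrite /= in_itv/= => u01; rewrite (le_trans (ler_norm_qform _ _))//.
  by rewrite ler_wpM2r ?sqr_ge0// Fk.
have -> : 2 * k * (`|t - s| / d) * rnorm x ^+ 2 =
  2 * (k * rnorm x ^+ 2) * (`|t - s| / d) by ring.
rewrite qformB; apply: (convex_function_lipschitz (op_convex01_qform x cF) qformk d0)
  => //; exact: D01.
Qed.

Lemma op_convex01_continuous F : op_convex01 F -> {in `]0, 1[, continuous F}.
Proof.
move=> cF t; rewrite in_itv/= => /andP[t0 t1].
pose k := 2 * rnorm (F ((0 + 1) / 2)) + rnorm (F 0) + rnorm (F 1).
pose d := Num.min t (1 - t).
have d0 : 0 < d by rewrite lt_min t0 subr_gt0.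
have [dt dt'] : d <= t /\ d <= 1 - t by rewrite !ge_min !lexx orbT.
apply: (@cvg_rnorm_squeeze _ _ _ (nbhs t) _ F _ (fun s => 2 * k * (`|t - s| / d))).
  apply: filterS (@cvgr_dist_le _ _ _ (nbhs t) _ id t cvg_id d d0) => s.
  apply: op_convex01_lipschitz => // u.
  exact: op_convex01_bounded.
have dist0 : `|t - s| @[s --> t] --> (0 : R).
  have -> : 0 = `|t - t| :> R by rewrite subrr normr0.
  by apply: cvg_norm; apply: cvgB; [exact: cvg_cst|exact: cvg_id].
have -> : 0 = 2 * k * (0 / d) :> R by rewrite mul0r mulr0.
by apply: cvgM; [exact: cvg_cst|apply: cvgM; [exact: dist0|exact: cvg_cst]].
Qed.

Lemma op_convex01_bochner (mu : {measure set (measurableTypeR R) -> \bar R}) F :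
  (mu D < +oo)%E -> op_convex01 F ->
  exists v, is_bochner mu D F v.
Proof.
move=> muD cF; apply: bounded_continuous_is_bochner muD _ (op_convex01_continuous cF).
by move=> t; rewrite in_itv/=; exact: op_convex01_bounded.
Qed.

Lemma is_bochner_op_convex01 (mu : {measure set (measurableTypeR R) -> \bar R}) F v :
  (mu D < +oo)%E -> op_convex01 F -> is_bochner mu D F v ->
  self_adjoint v /\
  forall x, qform v x = (\int[mu]_(t in D) qform (F t) x)%R.
Proof.
move=> muD cF Fv; have mD : measurable D by exact: measurable_itv.
split=> [|x]; last first.
  apply: (bochner_qform mD Fv).
  have := convex_function_integrable (op_convex01_qform x cF) muD; exact.
by apply: (bochner_self_adjoint mD _ Fv) => t; rewrite /= in_itv/=; exact: cF.1.
Qed.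

Lemma eta_hermite_hadamard F v b : 0 <= b <= 1 -> op_convex01 F ->
  is_bochner (eta b) D F v -> F b <=op v /\ v <=op nabla b (F 0) (F 1).
Proof.
move=> b01 cF /(is_bochner_op_convex01 (eta_itv01_lty b) cF)[sv vE].
have s0 : self_adjoint (F 0) by apply: cF.1; rewrite lexx ler01.
have s1 : self_adjoint (F 1) by apply: cF.1; rewrite lexx ler01.
split; apply/op_leP => //.
- exact: cF.1.
- by move=> x; rewrite vE (eta_jensen (op_convex01_qform x cF)).
- exact: self_adjoint_nabla.
- by move=> x; rewrite vE qform_nabla (eta_le_chord (op_convex01_qform x cF)).
Qed.

Lemma sigma_hermite_hadamard F v l (a : {i01 R}) : 0 <= l <= 1 -> op_convex01 F ->
  is_bochner (sigma l a) D F v ->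
  nabla a%:num (F l) (F (1 - l)) <=op v /\
  v <=op nabla (r_weight l a%:num) (F 0) (F 1).
Proof.
move=> l01 cF /(is_bochner_op_convex01 (sigma_itv01_lty l a) cF)[sv vE].
have sF t : 0 <= t <= 1 -> self_adjoint (F t) := cF.1 t.
have l01' : 0 <= 1 - l <= 1 by move: l01 => /andP[? ?]; apply/andP; split; lra.
split; apply/op_leP => //.
- by apply: self_adjoint_nabla; exact: sF.
- by move=> x; rewrite vE qform_nabla (sigma_jensen (op_convex01_qform x cF)).
- by apply: self_adjoint_nabla; apply: sF; rewrite lexx ler01.
- by move=> x; rewrite vE qform_nabla (sigma_le_chord (op_convex01_qform x cF)).
Qed.

End op_convex.

Section hermite_hadamard_chain.
Context {R : realType} {H : hilbertType R}.
Local Notation D := (`[0, 1]%classic : set (measurableTypeR R)).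
Implicit Types (F : R -> 'B(H)) (A B : 'B(H)).

Lemma nabla0 A B : nabla 0 A B = A.
Proof. by rewrite /nabla subr0 scale1r scale0r addr0. Qed.

Lemma nabla1 A B : nabla 1 A B = B.
Proof. by rewrite /nabla subrr scale1r scale0r add0r. Qed.

Lemma nablaN l A B : nabla l (- A) (- B) = - nabla l A B.
Proof. by rewrite /nabla !scalerN opprD. Qed.

Lemma nabla_nabla l s t A B :
  nabla l (nabla s A B) (nabla t A B) = nabla ((1 - l) * s + l * t) A B.
Proof.
rewrite /nabla !scalerDr !scalerA addrACA -!scalerDl -!rmorphM -!rmorphD.
by congr (_%:C *: _ + _%:C *: _); ring.
Qed.

Lemma op_leN A B : (- B <=op - A) = (A <=op B).
Proof. by rewrite /op_le opprK addrC. Qed.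

Lemma r_weight0 (l : R) : r_weight l 0 = l.
Proof. by rewrite /r_weight; ring. Qed.

Lemma r_weight1 (l : R) : r_weight l 1 = 1 - l.
Proof. by rewrite /r_weight; ring. Qed.

Lemma r_weight_itv01 (l t : R) : 0 <= l <= 1 -> 0 <= t <= 1 -> 0 <= r_weight l t <= 1.
Proof.
rewrite /r_weight => /andP[l0 l1] /andP[t0 t1].
by apply/andP; split; nra.
Qed.

Lemma op_convex01_r_weight F (l : R) : 0 <= l <= 1 -> op_convex01 F ->
  op_convex01 (fun t => F (r_weight l t)).
Proof.
move=> l01 [sF cF]; split=> [t t01|s t k s01 t01 k01].
  exact/sF/r_weight_itv01.
have -> : r_weight l ((1 - k) * s + k * t) =
    (1 - k) * r_weight l s + k * r_weight l t by rewrite /r_weight; ring.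
by apply: cF => //; exact: r_weight_itv01.
Qed.

Lemma is_bochner_hermite_hadamard F (l : R) (a : {i01 R}) v w : 0 <= l <= 1 ->
  op_convex01 F -> is_bochner (eta a%:num) D (fun t => F (r_weight l t)) v ->
  is_bochner (sigma l a) D F w ->
  [/\ F (r_weight l a%:num) <=op v,
      v <=op nabla a%:num (F l) (F (1 - l)),
      nabla a%:num (F l) (F (1 - l)) <=op w
    & w <=op nabla (r_weight l a%:num) (F 0) (F 1)].
Proof.
move=> l01 cF Fv Fw; have a01 : 0 <= a%:num <= 1 by apply/andP; split.
have [F_le_v] := eta_hermite_hadamard a01 (op_convex01_r_weight l01 cF) Fv.
rewrite r_weight0 r_weight1 => v_le_nabla.
by have [nabla_le_w w_le_nabla] := sigma_hermite_hadamard l01 cF Fw.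
Qed.

Lemma op_convex01_hermite_hadamard F (l : R) (a : {i01 R}) : 0 <= l <= 1 ->
  op_convex01 F ->
  [/\ F (r_weight l a%:num) <=op bochner (eta a%:num) D (fun t => F (r_weight l t)),
      bochner (eta a%:num) D (fun t => F (r_weight l t)) <=op
        nabla a%:num (F l) (F (1 - l)),
      nabla a%:num (F l) (F (1 - l)) <=op bochner (sigma l a) D F
    & bochner (sigma l a) D F <=op nabla (r_weight l a%:num) (F 0) (F 1)].
Proof.
move=> l01 cF; apply: (is_bochner_hermite_hadamard l01 cF); apply: bochnerP.
  exact: op_convex01_bochner (eta_itv01_lty _) (op_convex01_r_weight l01 cF).
exact: op_convex01_bochner (sigma_itv01_lty _ _) cF.
Qed.

Lemma op_convex01N_bochner (mu : {measure set (measurableTypeR R) -> \bar R}) F :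
  (mu D < +oo)%E -> op_convex01 (\- F) ->
  is_bochner mu D (\- F) (- bochner mu D F).
Proof.
move=> muD /(op_convex01_bochner muD)[v /is_bochnerN Fv].
apply/is_bochnerN/bochnerP; exists (- v); congr is_bochner : Fv.
by apply/funext => t; exact: opprK.
Qed.

Lemma op_concave01_hermite_hadamard F (l : R) (a : {i01 R}) : 0 <= l <= 1 ->
  op_convex01 (\- F) ->
  [/\ bochner (eta a%:num) D (fun t => F (r_weight l t)) <=op F (r_weight l a%:num),
      nabla a%:num (F l) (F (1 - l)) <=op
        bochner (eta a%:num) D (fun t => F (r_weight l t)),
      bochner (sigma l a) D F <=op nabla a%:num (F l) (F (1 - l))
    & nabla (r_weight l a%:num) (F 0) (F 1) <=op bochner (sigma l a) D F].
Proof.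
move=> l01 cF.
rewrite -!(op_leN (bochner _ _ _)) -!(op_leN _ (bochner _ _ _)) -!nablaN.
apply: (is_bochner_hermite_hadamard l01 cF).
  exact: op_convex01N_bochner (eta_itv01_lty _) (op_convex01_r_weight l01 cF).
exact: op_convex01N_bochner (sigma_itv01_lty _ _) cF.
Qed.

End hermite_hadamard_chain.

Section segment.
Context {R : realType} {H : hilbertType R}.
Variables (I : set R) (f : R -> R) (A B : 'B(H)).
Hypothesis itvI : is_interval I.
Hypotheses (IA : self_adjoint_on I A) (IB : self_adjoint_on I B).

Let F t := cfc f (nabla t A B).

Let F_self_adjoint t : self_adjoint (F t).
Proof. by apply/self_adjoint_cfc/self_adjoint_nabla; [case: IA|case: IB]. Qed.

Lemma operator_convex_segment : operator_convex H I f -> op_convex01 F.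
Proof.
move=> cf; split=> [t _|s t l s01 t01 l01]; first exact: F_self_adjoint.
by rewrite /F -nabla_nabla; apply: cf => //; exact: self_adjoint_on_nabla.
Qed.

Lemma operator_concave_segment : operator_concave H I f -> op_convex01 (\- F).
Proof.
move=> cf; split=> [t _|s t l s01 t01 l01].
  exact/self_adjointN/F_self_adjoint.
rewrite /= nablaN op_leN /F -nabla_nabla; apply: cf => //;
  exact: self_adjoint_on_nabla.
Qed.

End segment.

Theorem theorem2p5 (R : realType) (H : hilbertType R) (I : set R)
    (hI : is_interval I) (hI0 : I !=set0)
    (f : R -> R) (hf : {within I, continuous f})
    (l : R) (hl : 0 < l < 1) (a : {i01 R})
    (A B : 'B(H)) (hA : self_adjoint_on I A) (hB : self_adjoint_on I B) :
  (operator_convex H I f ->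
    [/\ cfc f (nabla (r_weight l a%:num) A B) <=op
          bochner (eta a%:num) `[0, 1] (fun t => cfc f (nabla (r_weight l t) A B)),
        bochner (eta a%:num) `[0, 1] (fun t => cfc f (nabla (r_weight l t) A B)) <=op
          nabla a%:num (cfc f (nabla l A B)) (cfc f (nabla (1 - l) A B)),
        nabla a%:num (cfc f (nabla l A B)) (cfc f (nabla (1 - l) A B)) <=op
          Mean l a f A B
      & Mean l a f A B <=op nabla (r_weight l a%:num) (cfc f A) (cfc f B)]) /\
  (operator_concave H I f ->
    [/\ bochner (eta a%:num) `[0, 1] (fun t => cfc f (nabla (r_weight l t) A B)) <=op
          cfc f (nabla (r_weight l a%:num) A B),
        nabla a%:num (cfc f (nabla l A B)) (cfc f (nabla (1 - l) A B)) <=op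
          bochner (eta a%:num) `[0, 1] (fun t => cfc f (nabla (r_weight l t) A B)),
        Mean l a f A B <=op
          nabla a%:num (cfc f (nabla l A B)) (cfc f (nabla (1 - l) A B))
      & nabla (r_weight l a%:num) (cfc f A) (cfc f B) <=op Mean l a f A B]).
Proof.
have l01 : 0 <= l <= 1 by have /andP[? ?] := hl; rewrite !ltW.
split=> cf.
  have := op_convex01_hermite_hadamard a l01 (operator_convex_segment hI hA hB cf).
  by rewrite nabla0 nabla1; exact.
have := op_concave01_hermite_hadamard a l01 (operator_concave_segment hI hA hB cf).
by rewrite nabla0 nabla1; exact.
Qed.
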